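(* Let $\{A(\lambda),B(\lambda),C(\lambda),D(\lambda)\}$ be a linear system quadruple, with $A(\lambda)\in\mathbb{C}[\lambda]^{d\times d}$ regular, realizing the rational matrix $R(\lambda):=C(\lambda)A(\lambda)^{-1}B(\lambda)+D(\lambda)\in\mathbb{C}(\lambda)^{m\times n}$. Then there exist unitary matrices $U,V\in\mathbb{C}^{d\times d}$ and $\widetilde W\in\mathbb{C}^{(d+m)\times(d+m)}$ such that $$\widetilde W\begin{bmatrix} U & 0\\ 0 & I_m\end{bmatrix}\begin{bmatrix} A(\lambda) & -B(\lambda)\\ C(\lambda) & D(\lambda)\end{bmatrix}\begin{bmatrix} V & 0\\ 0 & I_n\end{bmatrix}=\begin{bmatrix} X_{\overline o}(\lambda) & Y_{\overline o}(\lambda) & Z_{\overline o}(\lambda)\\ 0 & A_o(\lambda) & -B_o(\lambda)\\ 0 & C_o(\lambda) & D_o(\lambda)\end{bmatrix},$$ where $\widetilde W$ is of the form $$\widetilde W=\begin{bmatrix} \widetilde W_{11} & 0 & \widetilde W_{13}\\ 0 & I_{d_o} & 0\\ \widetilde W_{31} & 0 & \widetilde W_{33}\end{bmatrix}\in\mathbb{C}^{(d_{\overline o}+d_o+m)\times(d_{\overline o}+d_o+m)},$$ $d_{\overline o}$ is the number of (finite and infinite) eigenvalues of $\begin{bmatrix} A(\lambda)\\ C(\lambda)\end{bmatrix}$, $d=d_{\overline o}+d_o$, and $X_{\overline o}(\lambda)\in\mathbb{C}[\lambda]^{d_{\overline o}\times d_{\overline o}}$ is a regular pencil. Moreover: a)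 the eigenvalues of $\begin{bmatrix} A(\lambda)\\ C(\lambda)\end{bmatrix}$ are the eigenvalues of $X_{\overline o}(\lambda)$; b) $\begin{bmatrix} A_o(\lambda)\\ C_o(\lambda)\end{bmatrix}\in\mathbb{C}[\lambda]^{(d_o+m)\times d_o}$ has no (finite or infinite) eigenvalues; c) the quadruple $\{A_o(\lambda),B_o(\lambda),C_o(\lambda),D_o(\lambda)\}$ is a realization of the transfer function $R_o(\lambda):=\widetilde W_{33}R(\lambda)$, with $\widetilde W_{33}\in\mathbb{C}^{m\times m}$ invertible; d) if $\begin{bmatrix} A(\lambda) & -B(\lambda)\end{bmatrix}$ has no finite or infinite eigenvalues, then $\begin{bmatrix} A_o(\lambda) & -B_o(\lambda)\end{bmatrix}$ also has no finite or infinite eigenvalues.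
   Context: A linear system quadruple $\{A(\lambda),B(\lambda),C(\lambda),D(\lambda)\}$ consists of complex matrix pencils (polynomial matrices of the form $\lambda M_1-M_0$) of sizes $d\times d$, $d\times n$, $m\times d$, $m\times n$, respectively, with $A(\lambda)$ regular, i.e. $\det A(\lambda)\not\equiv 0$. It realizes (is a realization of) its transfer function $C(\lambda)A(\lambda)^{-1}B(\lambda)+D(\lambda)$. Eigenvalues are meant in the Kronecker sense, and all pencils are considered as having grade $1$. Every $p\times q$ pencil $P(\lambda)=\lambda P_1-P_0$ of normal rank $r$ (size of the largest not identically zero minor) is strictly equivalent to its Kronecker canonical form $$\mathrm{diag}\left(L_{\eta_1}^T(\lambda),\dots,L_{\eta_{p-r}}^T(\lambda),\ \lambda I_{r_f}-A_J,\ \lambda N-I_{r_\infty},\ L_{\epsilon_1}(\lambda),\dots,L_{\epsilon_{q-r}}(\lambda)\right),$$ with $A_J$ in Jordan form, $N$ nilpotent in Jordan form, and $L_k(\lambda)$ the $k\times(k+1)$ bidiagonal pencil with $\lambda$ on the diagonal and $1$ on the superdiagonal. The finite eigenvalues of $P$ are the $r_f$ eigenvalues of $A_J$, and $P$ has $r_\infty$ infinite eigenvalues. The number of (finite and infinite) eigenvalues is $r_f+r_\infty$ (counted with multiplicity). In particular, $P$ has no finite or infinite eigenvalues if and only if $\operatorname{rank}P(\lambda_0)=r$ for all $\lambda_0\in\mathbb{C}$ and $\operatorname{rank}P_1=r$. In the displayed identity the block partition of the right-hand side has row sizes $d_{\overline o},d_o,m$ and column sizes $d_{\overline o},d_o,n$.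 *)

(* Defs.v *)
From HB Require Import structures.
From mathcomp Require Import all_boot all_order all_algebra fraction spectral.
From mathcomp Require Import reals complex.

Set Implicit Arguments.
Unset Strict Implicit.
Unset Printing Implicit Defensive.

Import Order.TTheory GRing.Theory Num.Theory.
Local Open Scope ring_scope.

Section Pencils.
Variable K : fieldType.

Definition cst_mx p q (M : 'M[K]_(p, q)) : 'M[{poly K}]_(p, q) :=
  map_mx polyC M.

Definition rat_mx p q (M : 'M[{poly K}]_(p, q)) :
    'M[{fraction {poly K}}]_(p, q) :=
  map_mx (@FracField.tofrac {poly K}) M.

Definition is_pencil p q (P : 'M[{poly K}]_(p, q)) : Prop :=
  exists M1 M0 : 'M[K]_(p, q), P = 'X *: cst_mx M1 - cst_mx M0.

Definition is_regular p (P : 'M[{poly K}]_p) : Prop := \det P != 0.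

(* The constant matrices E and F being invertible, P and Q must have equal
   sizes; the sizes of Q are only propositionally those of P. *)
Definition strictly_equivalent p q p' q'
    (P : 'M[{poly K}]_(p, q)) (Q : 'M[{poly K}]_(p', q')) : Prop :=
  exists (e : (p = p') * (q = q')) (E : 'M[K]_p) (F : 'M[K]_q),
    [/\ E \in unitmx, F \in unitmx &
        castmx e (cst_mx E *m P *m cst_mx F) = Q].

Definition diag2 p q p' q' (P : 'M[{poly K}]_(p, q))
    (Q : 'M[{poly K}]_(p', q')) : 'M[{poly K}]_(p + p', q + q') :=
  block_mx P 0 0 Q.

Definition L_block k : 'M[{poly K}]_(k, k.+1) :=
  \matrix_(i < k, j < k.+1)
    (if j == i :> nat then 'X else if j == i.+1 :> nat then 1 else 0).

(* Blocks with k = 0 are allowed: L_0 is 0 x 1, that is, a zero column. *)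
Fixpoint L_blocks (ks : seq nat) :
    'M[{poly K}]_(sumn ks, sumn (map succn ks)) :=
  match ks with
  | [::] => 0
  | k :: ks' => diag2 (L_block k) (L_blocks ks')
  end.

Definition jordan_block (a : K) k : 'M[K]_k :=
  \matrix_(i < k, j < k)
    (if j == i :> nat then a else if j == i.+1 :> nat then 1 else 0).

Definition jordan_size (bs : seq (K * nat)) := sumn (map snd bs).

(* (a, k) stands for the k x k Jordan block with eigenvalue a. *)
Fixpoint jordan_mx (bs : seq (K * nat)) : 'M[K]_(jordan_size bs) :=
  match bs with
  | [::] => 0
  | b :: bs' => block_mx (jordan_block b.1 b.2) 0 0 (jordan_mx bs')
  end.

Definition nilpotent_blocks (ks : seq nat) : seq (K * nat) :=
  [seq (0, k) | k <- ks].

(* diag(L_eta^T, lambda I - A_J, lambda N - I, L_eps), with A_J and N in Jordan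
   form, N nilpotent with block sizes nu. *)
Definition kronecker_form (eta : seq nat) (fin : seq (K * nat))
    (nu eps : seq nat) :=
  diag2 (L_blocks eta)^T
    (diag2 ('X%:M - cst_mx (jordan_mx fin))
      (diag2 ('X *: cst_mx (jordan_mx (nilpotent_blocks nu)) - 1%:M)
        (L_blocks eps))).

(* Some a is the finite eigenvalue a, None the infinite eigenvalue. *)
Definition kronecker_eigenvalues (fin : seq (K * nat)) (nu : seq nat) :
    seq (option K) :=
  flatten [seq nseq b.2 (Some b.1) | b <- fin] ++ nseq (sumn nu) None.

(* s lists the finite and infinite eigenvalues of the pencil P, repeated
   according to multiplicity.  The Kronecker canonical form exists and is
   unique up to the order of its blocks, so s exists and is unique up to
   permutation. *)
Definition eigenvalues_of p q (P : 'M[{poly K}]_(p, q))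
    (s : seq (option K)) : Prop :=
  exists eta fin nu eps,
    strictly_equivalent P (kronecker_form eta fin nu eps) /\
    perm_eq s (kronecker_eigenvalues fin nu).

Definition no_eigenvalues p q (P : 'M[{poly K}]_(p, q)) : Prop :=
  eigenvalues_of P [::].

Definition linear_system_quadruple d m n
    (A : 'M[{poly K}]_d) (B : 'M[{poly K}]_(d, n))
    (C : 'M[{poly K}]_(m, d)) (D : 'M[{poly K}]_(m, n)) : Prop :=
  [/\ is_pencil A, is_pencil B, is_pencil C, is_pencil D & is_regular A].

Definition transfer_function d m n
    (A : 'M[{poly K}]_d) (B : 'M[{poly K}]_(d, n))
    (C : 'M[{poly K}]_(m, d)) (D : 'M[{poly K}]_(m, n)) :
    'M[{fraction {poly K}}]_(m, n) :=
  rat_mx C *m invmx (rat_mx A) *m rat_mx B + rat_mx D.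

Definition realizes d m n
    (A : 'M[{poly K}]_d) (B : 'M[{poly K}]_(d, n))
    (C : 'M[{poly K}]_(m, d)) (D : 'M[{poly K}]_(m, n))
    (G : 'M[{fraction {poly K}}]_(m, n)) : Prop :=
  linear_system_quadruple A B C D /\ transfer_function A B C D = G.

End Pencils.

(* Main.v *)
Require Import Defs.
From HB Require Import structures.
From mathcomp Require Import all_boot all_order all_algebra fraction spectral.
From mathcomp Require Import reals complex.
From mathcomp Require Import zify.

Set Implicit Arguments.
Unset Strict Implicit.
Unset Printing Implicit Defensive.

Import Order.TTheory GRing.Theory Num.Theory.
Local Open Scope ring_scope.

(** Write P for the pencil with blocks A and C on top of each other.  As A is
    regular, P has full column rank at some point c, so its Kronecker form is
    diag(X0, L^T): X0 is regular and carries all the eigenvalues, and L^T has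
    none.  If G P F = diag(X0, L^T), then the first columns F1 of F and E1 of
    the inverse of G satisfy P F1 = E1 X0.  Any unitary changes of bases that
    make F1 and E1 block upper triangular therefore make P block upper
    triangular, with a diagonal block equivalent to X0 and the other one
    equivalent to L^T ([deflation]).

    The theorem asks more of the row transformation: it must be an almost
    trivial W times diag(U, I).  Split E1 into the part Ea in the rows of A and
    the part Eb in the rows of C.  Choose U so that the last rows of U Ea
    vanish, and let S be what remains of it; then a unitary matrix acting on S
    on top of Eb only, that is, one that leaves the middle rows alone, finishes
    the triangularization ([unitary_staircase]).  At the point c the equation
    A F1 = Ea X0 shows that S is invertible, and this makes W33 invertible.  The
    middle and last block rows of the reduced system then give its transfer
    function by a short computation ([transfer_function_reduction]).  The
    statement on the row pencil of A and -B follows from a rank test: a pencil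
    of full row rank somewhere has no eigenvalues if and only if it has full
    row rank at every point and at infinity, and this passes to the last rows.

    It remains to obtain the Kronecker form of a pencil of full rank.  Working
    with rows instead of columns, assume first that the leading coefficient
    has full row rank; the pencil is then [X - A, B] with a constant B.  Put B
    in the form diag(I, 0).  Its identity block kills, through column
    operations, the rows of A that it meets, and what is left is a smaller
    pencil P' of the same kind, bordered by new rows X S and an identity block.
    Up to equivalence the bordering does not depend on how S completes the
    leading coefficient of P' ([border_indep]), so P' may be replaced by its
    Kronecker form, and bordering L_k yields L_(k+1).  This proves
    [state_input_form] by induction.  If the pencil X M1 - M0 has full row rank
    at c only, apply this to X (c M1 - M0) - M1, and again to the singular part
    of the result read in the original variable; its regular part splits by
    Fitting's lemma ([full_row_form]).  Finally the two regular parts are put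
    in Jordan form ([jordan_form], [nilpotent_jordan]). *)

(** * Strict equivalence *)

Section Basics.
Variable K : fieldType.

(** Invertibility is expressed with rectangular types, because the sizes of a
    block normal form agree with the original ones only propositionally. *)
Definition inverses p q (E : 'M[K]_(p, q)) (E' : 'M[K]_(q, p)) :=
  E *m E' = 1%:M /\ E' *m E = 1%:M.

Lemma inverses_sym p q (E : 'M_(p, q)) E' : inverses E E' -> inverses E' E.
Proof. by case. Qed.

Lemma inverses_dim p q (E : 'M_(p, q)) E' : inverses E E' -> p = q.
Proof.
by case=> h h'; apply/eqP; rewrite eqn_leq (mulmx1_min h) (mulmx1_min h').
Qed.

Lemma inverses1 p : inverses (1%:M : 'M_p) 1%:M.
Proof. by rewrite /inverses mul1mx. Qed.

Lemma inverses_unit p (E : 'M_p) : E \in unitmx -> inverses E (invmx E).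
Proof. by move=> uE; rewrite /inverses mulmxV // mulVmx. Qed.

Lemma inversesM p q r (E : 'M_(p, q)) E' (F : 'M_(q, r)) F' :
  inverses E E' -> inverses F F' -> inverses (E *m F) (F' *m E').
Proof.
case=> h1 h2 [h3 h4]; split.
  by rewrite mulmxA -(mulmxA E) h3 mulmx1.
by rewrite mulmxA -(mulmxA F') h2 mulmx1.
Qed.

Lemma inverses_tr p q (E : 'M_(p, q)) E' :
  inverses E E' -> inverses E'^T E^T.
Proof. by case=> h h'; split; rewrite -trmx_mul ?h ?h' trmx1. Qed.

Lemma inverses_diag p q r s (E : 'M_(p, q)) E' (F : 'M_(r, s)) F' :
  inverses E E' -> inverses F F' ->
  inverses (block_mx E 0 0 F) (block_mx E' 0 0 F').
Proof.
case=> h1 h2 [h3 h4]; split; rewrite mulmx_block !mul0mx !mulmx0 !addr0 !add0r.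
  by rewrite h1 h3 -scalar_mx_block.
by rewrite h2 h4 -scalar_mx_block.
Qed.

Lemma inverses_swap p q :
  inverses (block_mx 0 1%:M 1%:M 0 : 'M_(p + q, q + p))
           (block_mx 0 1%:M 1%:M 0).
Proof.
by split; rewrite mulmx_block !mul0mx !mulmx0 !mul1mx !addr0 !add0r
                  -scalar_mx_block.
Qed.

Lemma inverses_unitmx p q (E : 'M_(p, q)) E' (A : 'M_q) :
  inverses E E' -> E *m A *m E' \in unitmx -> A \in unitmx.
Proof.
move=> iE; have e := inverses_dim iE; case: _ / e in A E E' iE *.
case: iE => h1 h2; rewrite !unitmx_mul => /andP[/andP[_ ]] //.
Qed.

Lemma cst_mxM p q r (M : 'M[K]_(p, q)) (N : 'M_(q, r)) :
  cst_mx (M *m N) = cst_mx M *m cst_mx N.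
Proof. exact: map_mxM. Qed.

Lemma cst_mx1 p : cst_mx (1%:M : 'M[K]_p) = 1%:M.
Proof. exact: map_mx1. Qed.

Lemma cst_mx0 p q : cst_mx (0 : 'M[K]_(p, q)) = 0.
Proof. exact: map_mx0. Qed.

Lemma cst_mxN p q (M : 'M[K]_(p, q)) : cst_mx (- M) = - cst_mx M.
Proof. exact: map_mxN. Qed.

Lemma cst_mxD p q (M N : 'M[K]_(p, q)) : cst_mx (M + N) = cst_mx M + cst_mx N.
Proof. exact: map_mxD. Qed.

Lemma cst_mx_tr p q (M : 'M[K]_(p, q)) : cst_mx M^T = (cst_mx M)^T.
Proof. by rewrite /cst_mx map_trmx. Qed.

Lemma cst_mx_block p q r s (M : 'M[K]_(p, q)) (N : 'M_(p, r)) (M' : 'M_(s, q))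
    (N' : 'M_(s, r)) :
  cst_mx (block_mx M N M' N') =
  block_mx (cst_mx M) (cst_mx N) (cst_mx M') (cst_mx N').
Proof. exact: map_block_mx. Qed.

Lemma cst_mx_row p q r (M : 'M[K]_(p, q)) (N : 'M_(p, r)) :
  cst_mx (row_mx M N) = row_mx (cst_mx M) (cst_mx N).
Proof. exact: map_row_mx. Qed.

Lemma cst_mx_col p q r (M : 'M[K]_(p, q)) (N : 'M_(r, q)) :
  cst_mx (col_mx M N) = col_mx (cst_mx M) (cst_mx N).
Proof. exact: map_col_mx. Qed.

Lemma cst_inverses p q (E : 'M[K]_(p, q)) E' : inverses E E' ->
  cst_mx E *m cst_mx E' = 1%:M /\ cst_mx E' *m cst_mx E = 1%:M.
Proof. by case=> h1 h2; rewrite -!cst_mxM h1 h2 !cst_mx1. Qed.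

(** Strict equivalence without casts ([eqv_strictP]). *)
Definition pencil_eqv p q p' q'
    (P : 'M[{poly K}]_(p, q)) (Q : 'M[{poly K}]_(p', q')) : Prop :=
  exists (E : 'M[K]_(p', p)) (E' : 'M[K]_(p, p'))
         (F : 'M[K]_(q, q')) (F' : 'M[K]_(q', q)),
    [/\ inverses E E', inverses F F' & cst_mx E *m P *m cst_mx F = Q].

Local Notation "P =~ Q" := (pencil_eqv P Q) (at level 70, no associativity).

Lemma eqv_refl p q (P : 'M_(p, q)) : P =~ P.
Proof.
exists 1%:M, 1%:M, 1%:M, 1%:M.
by rewrite !cst_mx1 mul1mx mulmx1; split=> //; apply: inverses1.
Qed.

Lemma eqv_sym p q p' q' (P : 'M_(p, q)) (Q : 'M_(p', q')) : P =~ Q -> Q =~ P.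
Proof.
case=> E [E' [F [F' [iE iF <-]]]]; exists E', E, F', F.
have [_ hE] := cst_inverses iE; have [hF _] := cst_inverses iF.
split; [exact: inverses_sym | exact: inverses_sym |].
by rewrite !mulmxA hE mul1mx -mulmxA hF mulmx1.
Qed.

Lemma eqv_trans p q p' q' p'' q'' (P : 'M_(p, q)) (Q : 'M_(p', q'))
    (S : 'M_(p'', q'')) : P =~ Q -> Q =~ S -> P =~ S.
Proof.
case=> E [E' [F [F' [iE iF <-]]]] [G [G' [H [H' [iG iH <-]]]]].
exists (G *m E), (E' *m G'), (F *m H), (H' *m F').
split; [exact: inversesM | exact: inversesM |].
by rewrite !cst_mxM !mulmxA.
Qed.

Lemma eqv_cast p q p' q' (e : (p = p') * (q = q')) (P : 'M_(p, q)) :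
  castmx e P =~ P.
Proof.
by case: e => e1 e2; case: _ / e1; case: _ / e2; rewrite castmx_id; apply: eqv_refl.
Qed.

Lemma eqv_strictP p q p' q' (P : 'M_(p, q)) (Q : 'M_(p', q')) :
  P =~ Q <-> strictly_equivalent P Q.
Proof.
split=> [[E [E' [F [F' [iE iF defQ]]]]]|].
  have e1 := inverses_dim iE; have e2 := inverses_dim iF.
  move: E E' F F' Q iE iF defQ; rewrite e1 -e2 => E E' F F' Q [hE1 hE2] [hF1 hF2] <-.
  exists (erefl, erefl), E, F; rewrite castmx_id; split=> //.
    by have [] := mulmx1_unit hE1.
  by have [] := mulmx1_unit hF1.
case=> -[e1 e2] [E [F [uE uF <-]]]; case: _ / e1; case: _ / e2.
rewrite castmx_id; exists E, (invmx E), F, (invmx F).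
by split=> //; apply: inverses_unit.
Qed.

Lemma eqv_tr p q p' q' (P : 'M_(p, q)) (Q : 'M_(p', q')) :
  P =~ Q -> P^T =~ Q^T.
Proof.
case=> E [E' [F [F' [iE iF <-]]]]; exists F^T, F'^T, E^T, E'^T.
split; [exact/inverses_tr/inverses_sym | exact/inverses_tr/inverses_sym |].
by rewrite !trmx_mul !cst_mx_tr mulmxA.
Qed.

Lemma eqv_diag2 p q p' q' r s r' s' (P : 'M_(p, q)) (P' : 'M_(p', q'))
    (Q : 'M_(r, s)) (Q' : 'M_(r', s')) :
  P =~ P' -> Q =~ Q' -> diag2 P Q =~ diag2 P' Q'.
Proof.
case=> E [E' [F [F' [iE iF <-]]]] [G [G' [H [H' [iG iH <-]]]]].
exists (block_mx E 0 0 G), (block_mx E' 0 0 G').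
exists (block_mx F 0 0 H), (block_mx F' 0 0 H').
split; [exact: inverses_diag | exact: inverses_diag |].
rewrite !cst_mx_block !cst_mx0 /diag2 !mulmx_block.
by rewrite !(mul0mx, mulmx0, addr0, add0r).
Qed.

Lemma eqv_diag2C p q r s (P : 'M_(p, q)) (Q : 'M_(r, s)) :
  diag2 P Q =~ diag2 Q P.
Proof.
exists (block_mx 0 1%:M 1%:M 0), (block_mx 0 1%:M 1%:M 0).
exists (block_mx 0 1%:M 1%:M 0), (block_mx 0 1%:M 1%:M 0).
split; [exact: inverses_swap | exact: inverses_swap |].
rewrite !cst_mx_block !cst_mx0 !cst_mx1 /diag2 !mulmx_block.
by rewrite !(mul0mx, mulmx0, addr0, add0r, mul1mx, mulmx1).
Qed.

Lemma eqv_diag2A p q r s t u (P : 'M_(p, q)) (Q : 'M_(r, s)) (S : 'M_(t, u)) :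
  diag2 P (diag2 Q S) =~ diag2 (diag2 P Q) S.
Proof.
have := @block_mxA _ _ _ _ _ _ _ P 0 0 0 Q 0 0 0 S.
rewrite /= !row_mx0 !col_mx0 => h.
by rewrite /diag2 h; apply: eqv_cast.
Qed.

(** The empty blocks of a Kronecker form can be dropped: this is how a form
    without eigenvalues of some kind loses the corresponding block. *)
Lemma eqv_diag2_0l p q r s (Z : 'M_(r, s)) (P : 'M_(p, q)) :
  r = 0%N -> s = 0%N -> diag2 Z P =~ P.
Proof.
move=> r0 s0; rewrite r0 s0 in Z *.
exists (row_mx 0 1%:M), (col_mx 0 1%:M), (col_mx 0 1%:M), (row_mx 0 1%:M).
have h k : inverses (row_mx 0 1%:M : 'M_(k, 0 + k)) (col_mx 0 1%:M).
  split; first by rewrite mul_row_col mul0mx add0r mul1mx.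
  by rewrite mul_col_row !mul0mx mulmx0 mul1mx [RHS]scalar_mx_block [1%:M in RHS]flatmx0.
split; [exact: h | exact/inverses_sym/h |].
rewrite cst_mx_row cst_mx_col !cst_mx0 !cst_mx1 mul_row_block mul_row_col.
by rewrite !(mul0mx, mulmx0, mul1mx, mulmx1, addr0, add0r).
Qed.

Lemma eqv_diag2_0r p q r s (Z : 'M_(r, s)) (P : 'M_(p, q)) :
  r = 0%N -> s = 0%N -> diag2 P Z =~ P.
Proof.
by move=> r0 s0; apply: eqv_trans (eqv_diag2C _ _) (eqv_diag2_0l _ _ r0 s0).
Qed.

Lemma tr_diag2 p q r s (P : 'M[{poly K}]_(p, q)) (Q : 'M_(r, s)) :
  (diag2 P Q)^T = diag2 P^T Q^T.
Proof. by rewrite /diag2 tr_block_mx !trmx0. Qed.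

Definition pencil p q (M1 M0 : 'M[K]_(p, q)) : 'M[{poly K}]_(p, q) :=
  'X *: cst_mx M1 - cst_mx M0.

Lemma coef_pencil p q (M1 M0 : 'M[K]_(p, q)) i j k :
  (pencil M1 M0 i j)`_k =
  if k == 1%N then M1 i j else if k == 0%N then - M0 i j else 0.
Proof.
rewrite !mxE coefB coefXM !coefC.
by case: k => [|[|k]] /=; rewrite ?subr0 ?sub0r.
Qed.

Lemma pencil_inj p q (M1 M0 N1 N0 : 'M[K]_(p, q)) :
  pencil M1 M0 = pencil N1 N0 -> M1 = N1 /\ M0 = N0.
Proof.
move=> /matrixP h; split; apply/matrixP=> i j; move: (h i j) => /polyP hij.
  by have := hij 1%N; rewrite !coef_pencil.
by have := hij 0%N; rewrite !coef_pencil => /oppr_inj.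
Qed.

Lemma is_pencilP p q (P : 'M[{poly K}]_(p, q)) :
  is_pencil P <-> (forall i j, (size (P i j) <= 2)%N).
Proof.
split=> [[M1 [M0 ->]] i j|h].
  apply/leq_sizeP=> k; rewrite coef_pencil; by case: k => [|[]].
exists (\matrix_(i, j) (P i j)`_1), (\matrix_(i, j) - (P i j)`_0).
apply/matrixP=> i j; apply/polyP=> k; rewrite coef_pencil !mxE opprK.
by case: k => [|[|k]] //=; rewrite nth_default // (leq_trans (h i j)).
Qed.

Lemma mul_cst_pencil p q r s (E : 'M[K]_(r, p)) (M1 M0 : 'M_(p, q))
    (F : 'M_(q, s)) :
  cst_mx E *m pencil M1 M0 *m cst_mx F = pencil (E *m M1 *m F) (E *m M0 *m F).
Proof.
by rewrite /pencil mulmxBr mulmxBl -!scalemxAr -scalemxAl -!cst_mxM.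
Qed.

Lemma tr_pencil p q (M1 M0 : 'M[K]_(p, q)) :
  (pencil M1 M0)^T = pencil M1^T M0^T.
Proof. by rewrite /pencil linearB linearZ /= !cst_mx_tr. Qed.

Lemma eqv_pencil p q r s (E : 'M[K]_(r, p)) E' (M1 M0 : 'M_(p, q))
    (F : 'M_(q, s)) F' : inverses E E' -> inverses F F' ->
  pencil M1 M0 =~ pencil (E *m M1 *m F) (E *m M0 *m F).
Proof.
by move=> iE iF; rewrite -mul_cst_pencil; exists E, E', F, F'.
Qed.

Lemma diag2_pencil p q r s (M1 M0 : 'M[K]_(p, q)) (N1 N0 : 'M_(r, s)) :
  diag2 (pencil M1 M0) (pencil N1 N0) =
  pencil (block_mx M1 0 0 N1) (block_mx M0 0 0 N0).
Proof.
rewrite /diag2 /pencil !cst_mx_block !cst_mx0 scale_block_mx !scaler0.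
by rewrite opp_block_mx add_block_mx !oppr0 !addr0.
Qed.

Lemma char_pencil p (A : 'M[K]_p) : 'X%:M - cst_mx A = pencil 1%:M A.
Proof. by rewrite /pencil cst_mx1 scalemx1. Qed.

Lemma inf_pencil p (N : 'M[K]_p) : 'X *: cst_mx N - 1%:M = pencil N 1%:M.
Proof. by rewrite /pencil cst_mx1. Qed.

End Basics.

Local Notation "P =~ Q" := (pencil_eqv P Q) (at level 70, no associativity).

(** * Bordered pencils *)

Section Bordering.
Variable K : fieldType.

(** The last row of L_(k+1) is such a border of L_k; here S marks the columns
    that receive the new rows. *)
Definition border p q r (P : 'M[{poly K}]_(p, q)) (S : 'M[K]_(r, q)) :
    'M[{poly K}]_(p + r, q + r) :=
  block_mx P 0 ('X *: cst_mx S) 1%:M.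

Lemma border_eqv p q p' q' r (P : 'M_(p, q)) (P' : 'M_(p', q'))
    (S : 'M[K]_(r, q)) (E : 'M_(p', p)) E' (F : 'M_(q, q')) F' :
  inverses E E' -> inverses F F' -> cst_mx E *m P *m cst_mx F = P' ->
  border P S =~ border P' (S *m F).
Proof.
move=> iE iF <-; exists (block_mx E 0 0 1%:M), (block_mx E' 0 0 1%:M).
exists (block_mx F 0 0 1%:M), (block_mx F' 0 0 1%:M).
split; [exact/inverses_diag/inverses1 | exact/inverses_diag/inverses1 |].
rewrite /border !cst_mx_block !cst_mx0 !cst_mx1 !mulmx_block cst_mxM.
by rewrite !(mul0mx, mulmx0, mul1mx, mulmx1, addr0, add0r) scalemxAl.
Qed.

(** Write S = T M1 + T0 S', with T0 invertible.  A row operation replaces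
    X T M1 by the constant T M0, which the identity block then clears by a
    column operation; T0 is absorbed by a change of basis in the border. *)
Lemma border_indep p q r (M1 M0 : 'M[K]_(p, q)) (S S' : 'M_(r, q)) G G' :
  inverses (col_mx M1 S) G -> inverses (col_mx M1 S') G' ->
  border (pencil M1 M0) S =~ border (pencil M1 M0) S'.
Proof.
move=> iG iG'.
pose T := lsubmx (S *m G'); pose T0 := rsubmx (S *m G').
have defS : S = T *m M1 + T0 *m S'.
  by rewrite -mul_row_col hsubmxK -mulmxA iG'.2 mulmx1.
have uT0 : T0 \in unitmx.
  have [h _] := inversesM iG (inverses_sym iG'); have [] := mulmx1_unit h.
  have -> : col_mx M1 S *m G' = block_mx 1%:M 0 T T0.
    have -> : col_mx M1 S = block_mx 1%:M 0 T T0 *m col_mx M1 S'.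
      by rewrite mul_block_col mul1mx mul0mx addr0 -defS.
    by rewrite -mulmxA iG'.1 mulmx1.
  by rewrite !unitmxE det_lblock det1 mul1r.
pose E := block_mx 1%:M 0 (- (invmx T0 *m T)) (invmx T0) : 'M[K]_(p + r).
pose F := block_mx 1%:M 0 (- (T *m M0)) T0 : 'M[K]_(q + r).
have uE : E \in unitmx by rewrite !unitmxE det_lblock det1 mul1r -unitmxE unitmx_inv.
have uF : F \in unitmx by rewrite !unitmxE det_lblock det1 mul1r.
exists E, (invmx E), F, (invmx F).
split; [exact: inverses_unit | exact: inverses_unit |].
rewrite /border !cst_mx_block !cst_mx0 !cst_mx1 !mulmx_block.
rewrite !(mul0mx, mulmx0, mul1mx, mulmx1, addr0, add0r).
congr block_mx; last by rewrite -cst_mxM mulVmx // cst_mx1.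
have -> : 'X *: cst_mx S = cst_mx T *m pencil M1 M0 + cst_mx (T *m M0)
                          + cst_mx T0 *m ('X *: cst_mx S').
  rewrite {1}defS /pencil cst_mxD !cst_mxM scalerDr mulmxBr subrK.
  by rewrite -!scalemxAr.
move: (pencil M1 M0) => P.
rewrite !cst_mxN mulNmx mulmxN !mulmxDr !mulmxA -!cst_mxM mulVmx // cst_mx1.
by rewrite mul1mx -!addrA addKr addrC subrK.
Qed.

(** The border must complete the leading coefficient to an invertible matrix:
    by [border_indep] it is then irrelevant which completion is chosen. *)
Definition border_extension p q p' q' (P : 'M[{poly K}]_(p, q))
    (P' : 'M[{poly K}]_(p', q')) r : Prop :=
  exists (M1 M0 : 'M_(p, q)) (S : 'M_(r, q)) G,
    [/\ P = pencil M1 M0, inverses (col_mx M1 S) G & border P S =~ P'].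

(** Exchanging the two middle blocks turns a border of a diagonal sum into the
    diagonal sum of the borders. *)
Lemma inverses_shuffle p q r s :
  inverses (block_mx (block_mx 1%:M 0 0 0) (block_mx 0 0 1%:M 0)
                     (block_mx 0 1%:M 0 0) (block_mx 0 0 0 1%:M)
              : 'M[K]_((p + q) + (r + s), (p + r) + (q + s)))
           (block_mx (block_mx 1%:M 0 0 0) (block_mx 0 0 1%:M 0)
                     (block_mx 0 1%:M 0 0) (block_mx 0 0 0 1%:M)).
Proof.
split; rewrite !mulmx_block !(mul0mx, mulmx0, mul1mx, mulmx1, addr0, add0r);
  rewrite !add_block_mx !(addr0, add0r) ?block_mx0;
  by rewrite -!scalar_mx_block.
Qed.

Lemma border_extension_diag2 p q p' q' r t u t' u' s
    (P : 'M_(p, q)) (P' : 'M_(p', q')) (Q : 'M_(t, u)) (Q' : 'M_(t', u')) :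
  border_extension P P' r -> border_extension Q Q' s ->
  border_extension (diag2 P Q) (diag2 P' Q') (r + s).
Proof.
move=> [M1 [M0 [S [G [-> iG bP]]]]] [N1 [N0 [T [H [-> iH bQ]]]]].
exists (block_mx M1 0 0 N1), (block_mx M0 0 0 N0), (block_mx S 0 0 T).
eexists; split; first exact: diag2_pencil.
  have := inversesM (inverses_shuffle p t r s) (inverses_diag iG iH).
  congr inverses.
  rewrite mulmx_block !(mul0mx, mulmx0, addr0, add0r) !mul_block_col.
  by rewrite !(mul0mx, mul1mx, addr0, add0r) block_mxEv; congr col_mx;
     rewrite block_mxEh; congr row_mx; rewrite -?col_mx0.
apply: eqv_trans (eqv_diag2 bP bQ).
apply: eqv_sym; do 4!eexists; split; first exact: inverses_shuffle.
  exact/inverses_sym/inverses_shuffle.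
rewrite /border /diag2 !cst_mx_block !cst_mx0 !cst_mx1.
rewrite !mulmx_block !(mul0mx, mulmx0, mul1mx, mulmx1, addr0, add0r).
rewrite !mulmx_block !add_block_mx.
rewrite !(mul0mx, mulmx0, mul1mx, mulmx1, addr0, add0r).
by rewrite scale_block_mx !scaler0 block_mx0 -scalar_mx_block.
Qed.

End Bordering.

(** * Pencils with leading coefficient of full row rank *)

Section StateInput.
Variable K : fieldType.

Lemma eqv_norows p q p' q' (P : 'M[{poly K}]_(p, q)) (Q : 'M_(p', q')) :
  p = 0%N -> p' = 0%N -> q = q' -> P =~ Q.
Proof.
move=> p0 p0' e; rewrite p0 in P *; rewrite p0' -e in Q *.
by rewrite (flatmx0 P) (flatmx0 Q); apply: eqv_refl.
Qed.

(** A square pencil X - A needs no border, its leading coefficient being already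
    invertible. *)
Lemma border_extension_char p (A : 'M[K]_p) :
  border_extension ('X%:M - cst_mx A) ('X%:M - cst_mx A) 0.
Proof.
exists 1%:M, A, 0, (row_mx 1%:M 0); split; first exact: char_pencil.
  split.
    rewrite mul_col_row mul1mx !mul0mx mulmx0 [RHS]scalar_mx_block.
    by congr block_mx; apply/esym/flatmx0.
  by rewrite mul_row_col mul1mx mul0mx addr0.
rewrite /border cst_mx0 scaler0; exact: eqv_diag2_0r.
Qed.

Definition L_lead k : 'M[K]_(k, k.+1) := \matrix_(i, j) (j == i :> nat)%:R.
Definition L_const k : 'M[K]_(k, k.+1) := - \matrix_(i, j) (j == i.+1 :> nat)%:R.

Lemma L_block_pencil k : L_block K k = pencil (L_lead k) (L_const k).
Proof.
apply/matrixP=> i j; rewrite !mxE polyCN opprK.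
case: eqP => [->|_] /=; first by rewrite ltn_eqF //= mulr1n mulr1 addr0.
by rewrite mulr0 add0r; case: eqP.
Qed.

Lemma border_extension_L_block k : border_extension (L_block K k) (L_block K k.+1) 1.
Proof.
have e : k.+1 = (k + 1)%N by rewrite addn1.
exists (L_lead k), (L_const k), (delta_mx 0 ord_max).
exists (castmx (erefl, e) 1%:M); split; first exact: L_block_pencil.
  have -> : col_mx (L_lead k) (delta_mx 0 ord_max) = castmx (e, erefl) 1%:M.
    apply/matrixP=> i j; rewrite mxE castmxE !mxE cast_ord_id -val_eqE /=.
    case: split_ordP => l -> /=; rewrite !mxE; first by rewrite eq_sym.
    by rewrite ord1 eqxx -val_eqE /= addn0 eq_sym.
  case: _ / e; rewrite !castmx_id; exact: inverses1.
apply: eqv_trans (eqv_cast (e, congr1 S e) _).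
have -> : castmx (e, congr1 S e) (L_block K k.+1) =
          border (L_block K k) (delta_mx 0 ord_max); last exact: eqv_refl.
apply/matrixP=> i j; rewrite castmxE !mxE /=.
case: split_ordP => l ->; rewrite !mxE; case: split_ordP => l' -> /=; rewrite !mxE //=.
- rewrite !ord1 /= addn0 (gtn_eqF (leqW (ltn_ord l))) eqSS.
  by rewrite (gtn_eqF (ltn_ord l)).
- rewrite !ord1 /= addn0 -val_eqE /= (ltn_eqF (ltn_ord l')).
  by case: eqP => _ /=; rewrite ?mulr1n ?mulr0n ?polyC1 ?polyC0 ?mulr1 ?mulr0.
- by rewrite !ord1 /= !addn0 gtn_eqF // !eqxx.
Qed.

Lemma border_extension_L_blocks eps :
  border_extension (L_blocks K eps) (L_blocks K (map succn eps)) (size eps).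
Proof.
elim: eps => [|k eps IH]; last first.
  exact: (border_extension_diag2 (border_extension_L_block k) IH).
exists 0, 0, 0, 0; rewrite col_mx0 /=; split.
- by rewrite /pencil cst_mx0 scaler0 subr0.
- by split; rewrite [LHS]flatmx0 [RHS]flatmx0.
- exact: eqv_norows.
Qed.

Lemma L_blocks_cat s t :
  diag2 (L_blocks K s) (L_blocks K t) =~ L_blocks K (s ++ t).
Proof.
elim: s => [|k s IH]; first exact: eqv_diag2_0l.
apply: eqv_trans (eqv_sym (eqv_diag2A _ _ _)) _.
exact/eqv_diag2/IH/eqv_refl.
Qed.

Lemma L_blocks_zero r : (0 : 'M_(0, r)) =~ L_blocks K (nseq r 0%N).
Proof. by apply: eqv_norows; rewrite ?map_nseq ?sumn_nseq ?mul0n ?mul1n. Qed.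

Lemma rank_form q r (B : 'M[K]_(q, r)) :
  exists t s r' (E : 'M_(t + s, q)) E' (F : 'M_(r, t + r')) F',
    [/\ inverses E E', inverses F F' & E *m B *m F = block_mx 1%:M 0 0 0].
Proof.
have := mulmx_ebase B; have := col_ebase_unit B; have := row_ebase_unit B.
move: (row_ebase B) (col_ebase B) (rank_leq_row B) (rank_leq_col B) => F E.
move: (\rank B) => t let_q let_r uF uE.
have [s es] : exists s, q = (t + s)%N by exists (q - t)%N; rewrite subnKC.
have [r' er] : exists r', r = (t + r')%N by exists (r - t)%N; rewrite subnKC.
subst q r => <-; exists t, s, r', (invmx E), E, (invmx F), F.
split; [exact/inverses_sym/inverses_unit | exact/inverses_sym/inverses_unit |].
by rewrite !mulmxA mulVmx // mul1mx mulmxK // pid_mx_block.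
Qed.

Lemma eqv_row0 p q r (P : 'M[{poly K}]_(p, q)) :
  row_mx P (0 : 'M_(p, r)) =~ diag2 P (0 : 'M_(0, r)).
Proof.
exists (col_mx 1%:M 0), (row_mx 1%:M 0), 1%:M, 1%:M; split.
- split; last by rewrite mul_row_col mul1mx mul0mx addr0.
  rewrite mul_col_row mul1mx !mul0mx mulmx0 [RHS]scalar_mx_block.
  by congr block_mx; apply/esym/flatmx0.
- exact: inverses1.
rewrite cst_mx1 mulmx1 cst_mx_col cst_mx0 cst_mx1 mul_col_row mul1mx.
by rewrite mulmx0 !mul0mx.
Qed.

(** State feedback: the identity block of the input matrix clears the first t
    rows of A by column operations. *)
Lemma feedback_reduction t s r' (A : 'M[K]_(t + s)) :
  row_mx ('X%:M - cst_mx A) (cst_mx (block_mx 1%:M 0 0 0 : 'M_(_, t + r')))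
  =~ diag2 (border (row_mx ('X%:M - cst_mx (drsubmx A))
                           (cst_mx (- dlsubmx A)))
                   (row_mx 0 1%:M : 'M_(t, s + t)))
           (0 : 'M_(0, r')).
Proof.
pose Fr := block_mx 1%:M 0 (col_mx (usubmx A) 0) 1%:M : 'M[K]_((t + s) + (t + r')).
have uF : Fr \in unitmx by rewrite unitmxE det_lblock !det1 mulr1 unitr1.
pose sw u v := block_mx 0 1%:M 1%:M 0 : 'M[K]_(u + v, v + u).
pose G := row_mx (block_mx (sw t s) 0 0 (col_mx 1%:M 0)) (col_mx 0 (col_mx 0 1%:M))
  : 'M[K]_((t + s) + (t + r'), ((s + t) + t) + r').
pose G' := col_mx (block_mx (sw s t) 0 0 (row_mx 1%:M 0)) (row_mx 0 (row_mx 0 1%:M))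
  : 'M[K]_(((s + t) + t) + r', (t + s) + (t + r')).
have iG : inverses G G'.
  split.
    rewrite /G /G' mul_row_col mulmx_block mul_col_row !mul_col_row.
    rewrite !(mul0mx, mulmx0, mul1mx, mulmx1, addr0, add0r).
    rewrite !add_block_mx !(addr0, add0r) (inverses_swap K t s).1.
    by rewrite -!scalar_mx_block.
  rewrite /G /G' mul_col_row mulmx_block mul_block_col mul_row_block mul_row_col.
  rewrite !(mul0mx, mulmx0, mul1mx, mulmx1, addr0, add0r).
  rewrite mul_block_col !mul_row_col.
  rewrite !(mul0mx, mulmx0, mul1mx, mulmx1, addr0, add0r).
  by rewrite col_mx0 row_mx0 -block_mxEv -!scalar_mx_block.
pose N := col_mx 0 (dsubmx A) : 'M[K]_(t + s).
pose B := block_mx 1%:M 0 0 0 : 'M[K]_(t + s, t + r').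
have step1 : row_mx ('X%:M - cst_mx A) (cst_mx B)
             =~ row_mx ('X%:M - cst_mx N) (cst_mx B).
  exists 1%:M, 1%:M, Fr, (invmx Fr).
  split; [exact: inverses1 | exact: inverses_unit |].
  rewrite cst_mx1 mul1mx !cst_mx_block !cst_mx0 !cst_mx1 mul_row_block.
  rewrite !mulmx1 mulmx0 add0r cst_mx_col cst_mx0 mul_block_col.
  rewrite !(mul0mx, mulmx0, mul1mx, mulmx1, addr0, add0r).
  congr row_mx; rewrite -{1}[A]vsubmxK /N !cst_mx_col cst_mx0 -addrA; congr (_ + _).
  by rewrite !opp_col_mx add_col_mx addNr oppr0 addr0.
apply/(eqv_trans step1)/eqv_trans/eqv_row0; rewrite /B; exists (sw s t), (sw t s), G, G'.
split=> //; first exact: inverses_swap.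
have -> : N = block_mx 0 0 (dlsubmx A) (drsubmx A).
  by rewrite block_mxEv row_mx0 hsubmxK.
rewrite /G /sw !(cst_mx_row, cst_mx_block, cst_mx_col) !(cst_mx0, cst_mx1) cst_mxN.
rewrite scalar_mx_block opp_block_mx add_block_mx !oppr0 !addr0 add0r.
rewrite !mul_mx_row mul_row_block mul_row_col !mulmx_block !mul_block_col.
rewrite !(mul0mx, mulmx0, mul1mx, mulmx1, addr0, add0r).
rewrite /border cst_mx_row cst_mx0 cst_mx1 scale_row_mx scaler0 scalemx1.
by rewrite col_mx0 (block_mxEh (row_mx _ _)) -block_mxEv.
Qed.

(** This is the Brunovsky form of the pair (A, B).  The state space shrinks from
    q to s = q - rank B in each step, and the chains L_k of the smaller pair
    become the chains L_(k+1), one for each of the rank B inputs used. *)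
Lemma state_input_form q r (A : 'M[K]_q) (B : 'M_(q, r)) :
  exists s (A' : 'M[K]_s) eps,
    row_mx ('X%:M - cst_mx A) (cst_mx B)
    =~ diag2 ('X%:M - cst_mx A') (L_blocks K eps).
Proof.
elim/ltn_ind: q => q IH in r A B *.
have [->|B_neq0] := eqVneq B 0.
  exists q, A, (nseq r 0%N); rewrite cst_mx0.
  apply: eqv_trans (eqv_row0 _ _) _.
  exact/eqv_diag2/L_blocks_zero/eqv_refl.
have [t [s [r' [E [E' [F [F' [iE iF defB]]]]]]]] := rank_form B.
have t_gt0 : (0 < t)%N.
  rewrite lt0n; apply: contra_neq B_neq0 => t0.
  have EBF0 : E *m B *m F = 0.
    rewrite defB; move: t0 {defB E E' F F' iE iF} => ->.
    by rewrite (flatmx0 1%:M) block_mx0.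
  rewrite -[B]mul1mx -iE.2 -[E' *m E *m B]mulmx1 -iF.1 !mulmxA.
  by rewrite -!mulmxA (mulmxA B) (mulmxA E) (mulmxA E) EBF0 mul0mx mulmx0.
pose A1 := E *m A *m E'.
have step1 : row_mx ('X%:M - cst_mx A) (cst_mx B)
             =~ row_mx ('X%:M - cst_mx A1) (cst_mx (block_mx 1%:M 0 0 0 : 'M_(t + s, t + r'))).
  exists E, E', (block_mx E' 0 0 F), (block_mx E 0 0 F').
  split=> //; first exact/inverses_diag/iF/inverses_sym.
  rewrite cst_mx_block !cst_mx0 mul_mx_row mul_row_block !mulmx0 addr0 add0r.
  rewrite -!cst_mxM defB !char_pencil mul_cst_pencil mulmx1.
  by case: iE => ->.
have lt_sq : (s < q)%N by rewrite -(inverses_dim iE) -[ltnLHS]add0n ltn_add2r.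
have [u [A' [eps hIH]]] := IH s lt_sq t (drsubmx A1) (- dlsubmx A1).
case: (hIH) => G [G' [H [H' [iG iH defK]]]].
exists u, A', (map succn eps ++ nseq r' 0%N).
apply: eqv_trans step1 _; apply: eqv_trans (feedback_reduction _ _) _.
apply: (@eqv_trans _ _ _ _ _ _ _ _
  (diag2 (diag2 ('X%:M - cst_mx A') (L_blocks K (map succn eps)))
         (L_blocks K (nseq r' 0%N)))); last first.
  apply: eqv_trans (eqv_sym (eqv_diag2A _ _ _)) _.
  exact/eqv_diag2/L_blocks_cat/eqv_refl.
apply: eqv_diag2 (L_blocks_zero _).
apply: eqv_trans (border_eqv _ iG iH defK) _.
have [M1 [M0 [S [L [defM iL bM]]]]] :=
  border_extension_diag2 (border_extension_char A') (border_extension_L_blocks eps).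
have defP : row_mx ('X%:M - cst_mx (drsubmx A1)) (cst_mx (- dlsubmx A1))
            = pencil (row_mx 1%:M 0) (row_mx (drsubmx A1) (dlsubmx A1)).
  rewrite /pencil !cst_mx_row scale_row_mx cst_mx0 scaler0 cst_mx1 scalemx1.
  by rewrite opp_row_mx add_row_mx add0r cst_mxN.
rewrite defM; rewrite defP mul_cst_pencil defM in defK.
have [defM1 _] := pencil_inj defK.
have iM : inverses (col_mx M1 (row_mx 0 1%:M *m H))
                   (H' *m block_mx G' 0 0 1%:M).
  have := inversesM (inverses_diag iG (inverses1 K t)) iH; congr inverses.
  by rewrite -defM1 block_mxEv mul_col_mx mul_mx_row mulmx1 mulmx0.
(* Both borders complete the same leading coefficient, so they have the same
   number of rows. *)
have et : t = (0 + size eps)%N.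
  by apply/eqP; rewrite -(eqn_add2l (u + sumn eps)) (inverses_dim iM) (inverses_dim iL).
move: iM; move: (row_mx 0 1%:M *m H) (H' *m _); rewrite et => S' L' iL'.
by apply: eqv_trans (border_indep M0 iL' iL) _; rewrite -defM.
Qed.

End StateInput.

(** * Similarity, Fitting's lemma and the Jordan form *)

Section Similarity.
Variable K : fieldType.

(** Similarity is handled as strict equivalence of characteristic pencils, so
    that all the block manipulations above apply to it; the leading coefficient
    1 forces the two transformations to be inverse to each other. *)
Lemma similarP p q (A : 'M[K]_p) (B : 'M[K]_q) :
  'X%:M - cst_mx A =~ 'X%:M - cst_mx B <->
  exists (E : 'M_(q, p)) E', inverses E E' /\ E *m A *m E' = B.
Proof.
rewrite !char_pencil; split=> [[E [E' [F [F' [iE iF]]]]]|[E [E' [iE <-]]]].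
  rewrite mul_cst_pencil => /pencil_inj[]; rewrite mulmx1 => hEF <-.
  exists E, E'; split=> //; suff -> : E' = F by [].
  by rewrite -[F]mul1mx -iE.2 -mulmxA hEF mulmx1.
have -> : pencil (1%:M : 'M_q) (E *m A *m E') =
          pencil (E *m 1%:M *m E') (E *m A *m E') by rewrite mulmx1 iE.1.
exact: eqv_pencil iE (inverses_sym iE).
Qed.

Lemma similar_shift p q (A : 'M[K]_p) (B : 'M[K]_q) a :
  'X%:M - cst_mx A =~ 'X%:M - cst_mx B ->
  'X%:M - cst_mx (A + a%:M) =~ 'X%:M - cst_mx (B + a%:M).
Proof.
move=> /similarP[E [E' [iE <-]]]; apply/similarP; exists E, E'; split=> //.
by rewrite mulmxDr mulmxDl mul_mx_scalar -scalemxAl iE.1 scalemx1.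
Qed.

Lemma char_block p q (A : 'M[K]_p) (B : 'M[K]_q) :
  'X%:M - cst_mx (block_mx A 0 0 B) = diag2 ('X%:M - cst_mx A) ('X%:M - cst_mx B).
Proof. by rewrite !char_pencil diag2_pencil -scalar_mx_block. Qed.

Lemma row_free_inverses p q (M : 'M[K]_(p, q)) :
  row_free M -> p = q -> exists M', inverses M M'.
Proof.
move=> + e; case: _ / e in M * => fM; exists (invmx M).
by apply: inverses_unit; rewrite -row_free_unit.
Qed.

Lemma mul_expmx p q (V : 'M[K]_(p, q)) A J k :
  V *m A = J *m V -> V *m (A ^+ k) = J ^+ k *m V.
Proof.
move=> h; elim: k => [|k IH]; first by rewrite !expr0 mulmx1 mul1mx.
by rewrite exprSr -mulmxE mulmxA IH -mulmxA h mulmxA exprSr -mulmxE.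
Qed.

(** The row space of V and the left kernel of F are invariant under A, and they
    are complementary because V F is invertible. *)
Lemma invariant_splitting n r (A : 'M[K]_n) (J J' : 'M_r) V F :
  V *m A = J *m V -> A *m F = F *m J' -> V *m F \in unitmx ->
  exists s (A' : 'M_s) (N : 'M_(s, n)),
    [/\ (r + s = n)%N, row_free N, N *m F = 0, N *m A = A' *m N &
        'X%:M - cst_mx A =~ 'X%:M - cst_mx (block_mx J 0 0 A')].
Proof.
move=> VA AF uVF; pose N := row_base (kermx F).
have NF0 : N *m F = 0.
  apply: (@row_full_inj _ _ _ _ (col_base (kermx F))); first exact: col_base_full.
  by rewrite mulmxA mulmx_base mulmx_ker mulmx0.
have /submxP[A' NA] : (N *m A <= N)%MS.
  rewrite (eq_row_base (kermx F)); apply/sub_kermxP; rewrite -mulmxA AF.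
  by rewrite mulmxA NF0 mul0mx.
have fN : row_free N by apply: row_base_free.
have rF : \rank F = r.
  apply/eqP; rewrite eqn_leq rank_leq_col -{1}(mxrank_unit uVF).
  exact: mxrankM_maxr.
have e : (r + \rank (kermx F) = n)%N by rewrite mxrank_ker rF subnKC // -rF rank_leq_row.
exists _, A', N; split=> //; apply/similarP.
have [|L iL] := row_free_inverses _ e (M := col_mx V N).
  apply: inj_row_free => x; rewrite -[x]hsubmxK mul_row_col => h.
  have x1 : lsubmx x = 0.
    have : (lsubmx x *m V + rsubmx x *m N) *m F = 0 by rewrite h mul0mx.
    rewrite mulmxDl -(mulmxA (rsubmx x)) NF0 mulmx0 addr0 -mulmxA => h0.
    by rewrite -[LHS](mulmxK uVF) h0 mul0mx.
  move: h; rewrite x1 mul0mx add0r => h.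
  by rewrite (row_free_inj fN (etrans h (esym (mul0mx _ _)))) row_mx0.
exists (col_mx V N), L; split=> //.
rewrite mul_col_mx VA NA.
have -> : col_mx (J *m V) (A' *m N) = block_mx J 0 0 A' *m col_mx V N.
  by rewrite mul_block_col !mul0mx addr0 add0r.
by rewrite -mulmxA iL.1 mulmx1.
Qed.

(** Once the ranks of the powers of A stabilize at A^k = F V, with F and V of full
    rank, V F is invertible, and [invariant_splitting] separates the image of
    A^k from its kernel. *)
Lemma fitting n (A : 'M[K]_n) :
  exists u (A1 : 'M_u) s (A2 : 'M_s),
    [/\ A1 \in unitmx, (exists k, A2 ^+ k = 0) &
        'X%:M - cst_mx A =~ 'X%:M - cst_mx (block_mx A1 0 0 A2)].
Proof.
have [k k_gt0 rk] : exists2 k, (0 < k)%N & \rank (A ^+ (k + k)) = \rank (A ^+ k).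
  suff h m k : (0 < k)%N -> (\rank (A ^+ k) < m)%N ->
      exists2 k, (0 < k)%N & \rank (A ^+ (k + k)) = \rank (A ^+ k).
    exact: (h _ 1%N) (ltnSn _).
  elim: m k => // m IH k k_gt0 hk.
  have [|ne] := eqVneq (\rank (A ^+ (k + k))) (\rank (A ^+ k)); first by exists k.
  apply: (IH (k + k)%N); first by rewrite addn_gt0 k_gt0.
  rewrite ltnS in hk; apply: leq_trans hk; rewrite ltn_neqAle ne exprD -mulmxE.
  exact: mxrankM_maxl.
pose B := A ^+ k.
have AB : A *m B = B *m A by rewrite mulmxE -exprS -exprSr.
have [r [F [V [defB fV fF rB eVB]]]] : exists r (F : 'M_(n, r)) (V : 'M_(r, n)),
    [/\ F *m V = B, row_free V, row_full F, \rank B = r & (V :=: B)%MS].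
  exists (\rank B), (col_base B), (row_base B).
  split=> //; [exact: mulmx_base | exact: row_base_free | exact: col_base_full |].
  exact: eq_row_base.
have uVF : V *m F \in unitmx.
  have BB : B *m B = F *m (V *m F) *m V by rewrite mulmxA defB -mulmxA defB.
  rewrite -row_free_unit /row_free; apply/eqP/(etrans _ (etrans rk rB)).
  by rewrite exprD -mulmxE -/B BB (mxrankMfree _ fV) (eqmxMfull _ fF).
have /submxP[J VA] : (V *m A <= V)%MS.
  by rewrite eVB (eqmxMr A eVB) -AB submxMl.
have /row_freeP[W VW] := fV.
have AF : A *m F = F *m (V *m A *m W).
  have FE : F = B *m W by rewrite -defB -mulmxA VW mulmx1.
  by rewrite [in LHS]FE !mulmxA AB defB.
have [s [A2 [N [_ fN NF NA simA]]]] := invariant_splitting VA AF uVF.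
exists _, J, s, A2; split=> //.
  have := mul_expmx k VA; rewrite -/B -defB mulmxA => /(row_free_inj fV) h.
  by move: uVF; rewrite h -(prednK k_gt0) exprS -mulmxE unitmx_mul => /andP[].
exists k; apply: (row_free_inj fN).
by rewrite mul0mx -(mul_expmx k NA) -/B -defB mulmxA NF mul0mx.
Qed.

(** Applied to the rows and columns of the powers of a nilpotent matrix, this sum
    and the next one say that chains span invariant subspaces on which the
    matrix acts as a Jordan block. *)
Lemma jordan_block_row k (f : nat -> K) (a : 'I_k) : f k = 0 ->
  \sum_(b < k) jordan_block 0 k a b * f b = f a.+1.
Proof.
move=> fk0; have [lt_ak|ge_ak] := ltnP a.+1 k.
  rewrite (bigD1 (Ordinal lt_ak)) //= mxE /= gtn_eqF // eqxx mul1r.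
  rewrite big1 ?addr0 // => b; rewrite -val_eqE /= => /negPf ne_b.
  by rewrite mxE ne_b; case: ifP; rewrite mul0r.
have -> : a.+1 = k by apply/eqP; rewrite eqn_leq ltn_ord.
rewrite fk0 big1 // => b _; rewrite mxE.
rewrite [b == a.+1 :> nat]ltn_eqF ?(leq_trans (ltn_ord b)) //.
by case: ifP; rewrite mul0r.
Qed.

Lemma jordan_block_col k (f : nat -> K) (b : 'I_k) :
  \sum_(a < k) f a * jordan_block 0 k a b = if b == 0%N :> nat then 0 else f b.-1.
Proof.
case: b => -[|b] lt_bk /=.
  by rewrite big1 // => a _; rewrite mxE /= if_same mulr0.
rewrite (bigD1 (Ordinal (ltnW lt_bk))) //= mxE /= gtn_eqF // eqxx mulr1.
rewrite big1 ?addr0 // => a; rewrite -val_eqE /= => /negPf ne_a.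
by rewrite mxE /= eqSS [b == a]eq_sym ne_a if_same mulr0.
Qed.

(** A longest chain splits off: if entry (i, j) of N^k is nonzero and N^(k+1) = 0,
    the rows i and the columns j of the powers of N span invariant subspaces on
    which N acts as a Jordan block, and their pairing is triangular with that
    entry on the diagonal. *)
Lemma nilpotent_jordan n (N : 'M[K]_n) k : N ^+ k = 0 ->
  exists nu, 'X%:M - cst_mx N =~ 'X%:M - cst_mx (jordan_mx (nilpotent_blocks K nu)).
Proof.
elim/ltn_ind: n => n IH in N k *; move=> Nk0.
have [n0|n_gt0] := posnP n.
  by exists [::]; apply: eqv_norows.
have {k Nk0}exk : exists k, N ^+ k == 0 by exists k; apply/eqP.
case: (ex_minnP exk) => -[|k] /eqP Nk0 mink.
  move: Nk0 => /matrixP/(_ (Ordinal n_gt0) (Ordinal n_gt0)) /eqP.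
  by rewrite expr0 !mxE eqxx oner_eq0.
have Nk : N ^+ k != 0.
  by apply/negP=> /mink; rewrite ltnn.
have [i [j Nij]] : exists i j, (N ^+ k) i j != 0.
  suff /existsP[i /existsP[j h]] : [exists i, exists j, (N ^+ k) i j != 0].
    by exists i, j.
  apply: contraNT Nk; rewrite negb_exists => /forallP h.
  apply/eqP/matrixP=> i j; rewrite mxE; apply/eqP.
  by move: (h i); rewrite negb_exists => /forallP/(_ j); rewrite negbK.
pose V := \matrix_(a < k.+1, l < n) (N ^+ a) i l.
pose F := \matrix_(l < n, b < k.+1) (N ^+ (k - b)) l j.
have VN : V *m N = jordan_block 0 k.+1 *m V.
  apply/matrixP=> a l; rewrite [RHS]mxE.
  under [RHS]eq_bigr do rewrite [V _ _]mxE.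
  rewrite (jordan_block_row (f := fun a => (N ^+ a) i l)); last by rewrite Nk0 mxE.
  by rewrite exprSr -mulmxE !mxE; apply: eq_bigr => x _; rewrite mxE.
have NF : N *m F = F *m jordan_block 0 k.+1.
  apply/matrixP=> l b; rewrite [RHS]mxE.
  under [RHS]eq_bigr do rewrite [F _ _]mxE.
  rewrite (jordan_block_col (fun a => (N ^+ (k - a)) l j)).
  have -> : (N *m F) l b = (N ^+ (k - b).+1) l j.
    by rewrite exprS -mulmxE !mxE; apply: eq_bigr => x _; rewrite mxE.
  have := ltn_ord b; case: eqP => [->|b0] lt_bk; first by rewrite subn0 Nk0 mxE.
  by have -> : (k - b).+1 = (k - b.-1)%N by lia.
have VFE a b : (V *m F) a b = (N ^+ (a + (k - b))) i j.
  by rewrite exprD -mulmxE !mxE; apply: eq_bigr => x _; rewrite !mxE.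
have uVF : V *m F \in unitmx.
  rewrite -unitmx_tr unitmxE det_trig; last first.
    apply/is_trig_mxP=> a b lt_ab; rewrite mxE VFE.
    have -> : (b + (k - a) = k.+1 + (b - a).-1)%N.
      by move: (ltn_ord a) (ltn_ord b) lt_ab; lia.
    by rewrite exprD Nk0 mul0r mxE.
  rewrite unitfE; apply/prodf_neq0 => a _.
  by rewrite mxE VFE subnKC // -ltnS.
have [s [N' [M [es fM _ MN sim]]]] := invariant_splitting VN NF uVF.
have lt_sn : (s < n)%N by rewrite -es addSn ltnS leq_addl.
have [|nu simN'] := IH s lt_sn N' k.+1.
  by apply: (row_free_inj fM); rewrite mul0mx -(mul_expmx _ MN) Nk0 mulmx0.
exists (k.+1 :: nu); apply: eqv_trans sim _.
rewrite char_block (char_block _ (jordan_mx (nilpotent_blocks K nu))).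
exact/eqv_diag2/simN'/eqv_refl.
Qed.

End Similarity.

(** * Pencils of full row rank at some point *)

Section SemiKronecker.
Variable K : fieldType.

Lemma row_free_block p q r s (A : 'M[K]_(p, q)) (B : 'M_(r, s)) :
  row_free A -> row_free B -> row_free (block_mx A 0 0 B).
Proof.
move=> /row_freeP[A' hA] /row_freeP[B' hB]; apply/row_freeP.
exists (block_mx A' 0 0 B'); rewrite mulmx_block !(mul0mx, mulmx0, addr0, add0r).
by rewrite hA hB -scalar_mx_block.
Qed.

Lemma row_free_colsub p q r (f : 'I_r -> 'I_q) (A : 'M[K]_(p, q)) :
  row_free (colsub f A) -> row_free A.
Proof.
move=> fA; apply: inj_row_free => x xA0; apply: (row_free_inj fA).
rewrite mul0mx; apply/rowP=> j; have /rowP/(_ (f j)) := xA0; rewrite !mxE => h.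
by rewrite -[RHS]h; apply: eq_bigr => i _; rewrite !mxE.
Qed.

(** Omitting the first column of L_k at a leaves a triangular matrix with unit
    diagonal; omitting the last column of its leading coefficient leaves 1. *)
Lemma L_block_row_free k a : row_free (a *: L_lead K k - L_const K k) /\ row_free (L_lead K k).
Proof.
split.
  apply: (@row_free_colsub _ _ _ (lift ord0)).
  rewrite row_free_unit unitmxE det_trig.
    rewrite unitfE; apply/prodf_neq0 => i _; rewrite !mxE opprK /= /bump /= add1n.
    by rewrite eqxx gtn_eqF // mulr0 add0r oner_neq0.
  apply/is_trig_mxP=> i j lt_ij; rewrite !mxE opprK /= /bump /= add1n eqSS.
  by rewrite !gtn_eqF ?mulr0 ?add0r // ltnW.
apply: (@row_free_colsub _ _ _ (widen_ord (leqnSn k))).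
rewrite row_free_unit (_ : colsub _ _ = 1%:M) ?unitmx1 //.
by apply/matrixP=> i j; rewrite !mxE eq_sym.
Qed.

Lemma L_blocks_pencil eps : exists M1 M0 : 'M[K]_(_, _),
  [/\ L_blocks K eps = pencil M1 M0, row_free M1 &
      forall a, row_free (a *: M1 - M0)].
Proof.
elim: eps => [|k eps [M1 [M0 [defL f1 fa]]]].
  exists 0, 0; split=> [||a].
  - by rewrite /pencil cst_mx0 scaler0 subr0.
  - by apply: inj_row_free => x _; apply/rowP=> -[].
  - by apply: inj_row_free => x _; apply/rowP=> -[].
exists (block_mx (L_lead K k) 0 0 M1), (block_mx (L_const K k) 0 0 M0); split=> [||a].
- by rewrite /= L_block_pencil defL; apply: diag2_pencil.
- exact: row_free_block (L_block_row_free k 0).2 f1.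
rewrite scale_block_mx !scaler0 opp_block_mx add_block_mx !oppr0 !addr0.
exact: row_free_block (L_block_row_free k a).1 (fa a).
Qed.

Lemma full_row_lead_form p q (M1 M0 : 'M[K]_(p, q)) : row_free M1 ->
  exists s (A : 'M[K]_s) eps,
    pencil M1 M0 =~ diag2 ('X%:M - cst_mx A) (L_blocks K eps).
Proof.
move=> /row_freeP[M1' M1K].
have [t [s [r' [E [E' [F [F' [iE iF defM]]]]]]]] := rank_form M1.
have s0 : s = 0%N.
  have h : row_mx 0 1%:M *m block_mx 1%:M 0 0 0 = 0 :> 'M[K]_(s, t + r').
    by rewrite mul_row_block !(mul0mx, mulmx0) !addr0 row_mx0.
  have : (row_mx 0 1%:M : 'M[K]_(s, t + s)) = 0.
    have : row_mx 0 1%:M *m (E *m M1 *m F) *m (F' *m M1' *m E') = 0.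
      by rewrite defM h mul0mx.
    rewrite !mulmxA -(mulmxA _ F) iF.1 mulmx1 -(mulmxA _ M1) M1K mulmx1.
    by rewrite -mulmxA iE.1 mulmx1.
  rewrite -row_mx0 => /eq_row_mx[_ /matrixP h1].
  case: s h1 {h E E' iE defM} => // s /(_ 0 0)/eqP.
  by rewrite !mxE eqxx oner_eq0.
subst s.
pose T := row_mx 1%:M 0 : 'M[K]_(t, t + 0).
have iT : inverses T (col_mx 1%:M 0).
  split; first by rewrite mul_row_col mul1mx mul0mx addr0.
  rewrite mul_col_row mul1mx !mul0mx mulmx0 [RHS]scalar_mx_block.
  by congr block_mx; apply/esym/flatmx0.
pose A := lsubmx (T *m E *m M0 *m F); pose B := rsubmx (T *m E *m M0 *m F).
have [s [A' [eps hAB]]] := state_input_form A (- B); exists s, A', eps.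
apply: eqv_trans (eqv_pencil M1 M0 (inversesM iT iE) iF) _.
have -> : T *m E *m M1 *m F = row_mx 1%:M 0.
  rewrite -!(mulmxA T) defM mul_row_block !(mul0mx, mulmx0, mul1mx).
  by rewrite !addr0.
suff -> : pencil (row_mx 1%:M 0) (T *m E *m M0 *m F) =
          row_mx ('X%:M - cst_mx A) (cst_mx (- B)) by [].
rewrite -[X in pencil _ X]hsubmxK /pencil !cst_mx_row scale_row_mx.
rewrite cst_mx0 scaler0 cst_mx1 scalemx1 opp_row_mx add_row_mx add0r.
by rewrite cst_mxN.
Qed.

(** Split A into an invertible and a nilpotent part and divide the
    first block by its leading coefficient, the second one by its constant
    coefficient. *)
Lemma regular_form n (A : 'M[K]_n) c :
  exists u (B : 'M[K]_u) s (N : 'M[K]_s) k, N ^+ k = 0 /\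
    pencil A (c *: A - 1%:M) =~
    diag2 ('X%:M - cst_mx B) ('X *: cst_mx N - 1%:M).
Proof.
have [u [A1 [s [A2 [uA1 [k A2k] /similarP[E [E' [iE defA]]]]]]]] := fitting A.
have uD : c *: A2 - 1%:M \in unitmx.
  have := subrX1 (c *: A2) k; rewrite -mulmxE => h.
  suff : (c *: A2 - 1%:M) *m - (\sum_(i < k) (c *: A2) ^+ i) = 1%:M by case/mulmx1_unit.
  rewrite mulmxN -h; have -> : (c *: A2) ^+ k = 0; last by rewrite sub0r opprK.
  have expZ j : (c *: A2) ^+ j = c ^+ j *: (A2 ^+ j).
    elim: j => [|j IH]; first by rewrite !expr0 scale1r.
    by rewrite !exprS IH -!mulmxE -scalemxAr -scalemxAl scalerA mulrC.
  by rewrite expZ A2k scaler0.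
set D := c *: A2 - 1%:M in uD.
exists u, (c%:M - invmx A1), s, (invmx D *m A2), k; split.
  have cD : D *m A2 = A2 *m D.
    by rewrite mulmxBl mulmxBr mul1mx mulmx1 -scalemxAl -scalemxAr.
  rewrite mulmxE exprMn_comm ?A2k ?mulr0 // /GRing.comm -mulmxE.
  by rewrite -[RHS](mulKmx uD) (mulmxA D) cD -(mulmxA A2) mulmxV // mulmx1.
rewrite char_pencil inf_pencil.
apply: eqv_trans (eqv_pencil _ _ iE (inverses_sym iE)) _.
have -> : E *m (c *: A - 1%:M) *m E' = block_mx (c *: A1 - 1%:M) 0 0 D.
  rewrite mulmxBr mulmxBl mulmx1 iE.1 -scalemxAr -scalemxAl defA.
  by rewrite scale_block_mx !scaler0 scalar_mx_block opp_block_mx add_block_mx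
             !oppr0 !addr0.
rewrite defA -diag2_pencil; apply: eqv_diag2.
  have := eqv_pencil A1 (c *: A1 - 1%:M) (inverses_sym (inverses_unit uA1)) (inverses1 K u).
  by rewrite !mulmx1 mulmxBr mulmx1 -scalemxAr mulVmx // scalemx1.
have := eqv_pencil A2 D (inverses_sym (inverses_unit uD)) (inverses1 K s).
by rewrite !mulmx1 mulVmx.
Qed.

(** The first use of [full_row_lead_form] exchanges the roles of the two
    coefficients, which sends the point c to infinity; undoing the exchange maps
    the chains to a pencil whose leading coefficient has full row rank, and this
    makes the second use possible. *)
Lemma full_row_form p q (M1 M0 : 'M[K]_(p, q)) c :
  row_free (c *: M1 - M0) ->
  exists u (A : 'M[K]_u) s (N : 'M[K]_s) k eps, N ^+ k = 0 /\
    pencil M1 M0 =~ diag2 ('X%:M - cst_mx A)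
                      (diag2 ('X *: cst_mx N - 1%:M) (L_blocks K eps)).
Proof.
move=> free_c; have [n [A0 [eps0 H]]] := full_row_lead_form M1 free_c.
have [L1s [L0s [defL _ freeL]]] := L_blocks_pencil eps0.
case: H => E [E' [F [F' [iE iF]]]].
rewrite defL char_pencil diag2_pencil mul_cst_pencil => /pencil_inj[h1 h0].
have fL0 : row_free L0s.
  by have := freeL 0; rewrite scale0r sub0r /row_free mxrank_opp.
have [u2 [A2 [eps hL]]] := full_row_lead_form (c *: L0s - L1s) fL0.
have [u1 [A1 [s [N [k [Nk hA]]]]]] := regular_form A0 c.
exists _, (block_mx A1 0 0 A2), s, N, k, eps; split=> //.
apply: eqv_trans (eqv_pencil M1 M0 iE iF) _.
have -> : E *m M0 *m F = c *: (E *m M1 *m F) - E *m (c *: M1 - M0) *m F.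
  by rewrite mulmxBr mulmxBl -scalemxAr -scalemxAl opprB addrC subrK.
rewrite h0 h1 scale_block_mx opp_block_mx add_block_mx !scaler0 !oppr0 !addr0.
rewrite -diag2_pencil; apply: eqv_trans (eqv_diag2 hA hL) _.
rewrite char_block.
apply: eqv_trans (eqv_diag2A _ _ _) _; apply: eqv_trans _ (eqv_sym (eqv_diag2A _ _ _)).
apply: eqv_diag2 (eqv_refl _).
apply: eqv_trans (eqv_sym (eqv_diag2A _ _ _)) _.
apply: eqv_trans _ (eqv_diag2A _ _ _).
exact: eqv_diag2 (eqv_refl _) (eqv_diag2C _ _).
Qed.

End SemiKronecker.

(** * Kronecker form over an algebraically closed field *)

Section JordanForm.
Variable K : fieldType.

Lemma similar_inf p q (A : 'M[K]_p) (B : 'M[K]_q) :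
  'X%:M - cst_mx A =~ 'X%:M - cst_mx B ->
  'X *: cst_mx A - 1%:M =~ 'X *: cst_mx B - 1%:M.
Proof.
move=> /similarP[E [E' [iE <-]]]; rewrite !inf_pencil.
have := eqv_pencil A 1%:M iE (inverses_sym iE).
by rewrite mulmx1 iE.1.
Qed.

Lemma jordan_shift nu (a : K) :
  'X%:M - cst_mx (jordan_mx (nilpotent_blocks K nu) + a%:M) =~
  'X%:M - cst_mx (jordan_mx [seq (a, k) | k <- nu]).
Proof.
elim: nu => [|k nu IH]; first exact: eqv_norows.
have -> : jordan_mx (nilpotent_blocks K (k :: nu)) + a%:M =
  block_mx (jordan_block a k) 0 0 (jordan_mx (nilpotent_blocks K nu) + a%:M).
  rewrite [a%:M]scalar_mx_block /= add_block_mx !addr0; congr block_mx.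
  apply/matrixP=> i j; rewrite !mxE -val_eqE /= eq_sym.
  by case: eqP => _; rewrite ?add0r ?addr0.
rewrite char_block (char_block _ (jordan_mx [seq (a, k) | k <- nu])).
exact: eqv_diag2 (eqv_refl _) IH.
Qed.

Lemma jordan_cat (bs cs : seq (K * nat)) :
  'X%:M - cst_mx (block_mx (jordan_mx bs) 0 0 (jordan_mx cs)) =~
  'X%:M - cst_mx (jordan_mx (bs ++ cs)).
Proof.
rewrite char_block; elim: bs => [|b bs IH]; first exact: eqv_diag2_0l.
rewrite (char_block (jordan_block b.1 b.2) (jordan_mx bs)).
rewrite (char_block _ (jordan_mx (bs ++ cs))).
apply: eqv_trans (eqv_sym (eqv_diag2A _ _ _)) _.
exact: eqv_diag2 (eqv_refl _) IH.
Qed.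

End JordanForm.

Section Kronecker.
Variable K : closedFieldType.

(** If a is an eigenvalue of A, the Fitting splitting of A - a has a nonempty
    nilpotent part, which gives the blocks for a; the other part is smaller. *)
Lemma jordan_form n (A : 'M[K]_n) :
  exists bs, 'X%:M - cst_mx A =~ 'X%:M - cst_mx (jordan_mx bs).
Proof.
elim/ltn_ind: n => n IH in A *.
have [n0|n_gt0] := posnP n; first by exists [::]; apply: eqv_norows.
have [a eig_a] : exists a, eigenvalue A a.
  have /closed_rootP[a root_a] : size (char_poly A) != 1%N.
    by rewrite size_char_poly eqSS -lt0n.
  by exists a; rewrite eigenvalue_root_char.
have [u [A1 [s [A2 [uA1 [k A2k] sim]]]]] := fitting (A - a%:M).
have s_gt0 : (0 < s)%N.
  rewrite lt0n; apply/eqP=> s0; subst s.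
  have /similarP[E [E' [iE defA]]] := sim.
  have /eigenvalueP[v vA] := eig_a; apply/negP; rewrite negbK -[v](mulmxK (_ : A - a%:M \in _)).
    by rewrite mulmxBr vA mul_mx_scalar subrr mul0mx.
  apply: (inverses_unitmx iE); rewrite defA unitmxE det_ublock det_mx00 mulr1.
  by rewrite -unitmxE.
have es : (u + s = n)%N by have /similarP[E [E' [iE _]]] := sim; apply: inverses_dim iE.
have lt_un : (u < n)%N by rewrite -es -[ltnLHS]addn0 ltn_add2l.
have [bs simA1] := IH u lt_un (A1 + a%:M); have [nu simA2] := nilpotent_jordan A2k.
exists (bs ++ [seq (a, k) | k <- nu]).
have := similar_shift a sim; rewrite subrK => simA; apply: eqv_trans simA _.
rewrite [a%:M]scalar_mx_block add_block_mx !addr0 char_block.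
apply: eqv_trans (jordan_cat _ _); rewrite char_block; apply: eqv_diag2 simA1 _.
exact: eqv_trans (similar_shift a simA2) (jordan_shift nu a).
Qed.

(** Transposing [full_row_form] comes first: the Jordan form is only reached
    afterwards, since the transpose of a Jordan block is not one. *)
Lemma full_column_kronecker p q (M1 M0 : 'M[K]_(p, q)) c :
  row_free (c *: M1 - M0)^T ->
  exists fin nu eta,
    pencil M1 M0 =~ diag2 (diag2 ('X%:M - cst_mx (jordan_mx fin))
      ('X *: cst_mx (jordan_mx (nilpotent_blocks K nu)) - 1%:M))
      (L_blocks K eta)^T.
Proof.
rewrite linearB linearZ /= => /full_row_form[u [A [s [N [k [eta [Nk sim]]]]]]].
have [fin simA] := jordan_form A^T.
have trX r (B : 'M[K]_r) j : (B ^+ j)^T = B^T ^+ j.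
  elim: j => [|j IH]; first by rewrite !expr0 trmx1.
  by rewrite exprS exprSr -!mulmxE trmx_mul IH.
have [|nu simN] := @nilpotent_jordan _ _ N^T k; first by rewrite -trX Nk trmx0.
exists fin, nu, eta.
have := eqv_tr sim.
rewrite tr_pencil !trmxK !tr_diag2 char_pencil inf_pencil !tr_pencil !trmx1.
move=> sim1; apply: eqv_trans sim1 _; apply: eqv_trans (eqv_diag2A _ _ _) _.
apply: eqv_diag2 (eqv_refl _); apply: eqv_diag2; first by rewrite -char_pencil.
by rewrite -inf_pencil; apply: similar_inf.
Qed.

End Kronecker.

(** * The rank test for the absence of eigenvalues *)

Section RankCriterion.
Variable K : closedFieldType.

Lemma row_free_mull p q r (A : 'M[K]_(p, q)) (B : 'M_(q, r)) :
  row_free (A *m B) -> row_free A.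
Proof.
by case/row_freeP=> L h; apply/row_freeP; exists (B *m L); rewrite mulmxA.
Qed.

Lemma row_freeM p q r (A : 'M[K]_(p, q)) (B : 'M_(q, r)) :
  row_free A -> row_free B -> row_free (A *m B).
Proof. by move=> fA fB; rewrite /row_free mxrankMfree. Qed.

Lemma inverses_free p q (E : 'M[K]_(p, q)) E' : inverses E E' -> row_free E.
Proof. by case=> h _; apply/row_freeP; exists E'. Qed.

Lemma row_free_equiv p q r s (E : 'M[K]_(r, p)) E' (M : 'M_(p, q))
    (F : 'M_(q, s)) F' :
  inverses E E' -> inverses F F' -> row_free (E *m M *m F) = row_free M.
Proof.
move=> iE iF; apply/idP/idP=> [h|h]; last first.
  by apply: row_freeM (inverses_free iF); apply: row_freeM (inverses_free iE) _.
have -> : M = E' *m (E *m M *m F *m F').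
  by rewrite -mulmxA iF.1 mulmx1 mulmxA iE.2 mul1mx.
apply: row_freeM (inverses_free (inverses_sym iE)) _.
exact: row_freeM h (inverses_free (inverses_sym iF)).
Qed.

Lemma row_free_ul p q r s (A : 'M[K]_(p, q)) (B : 'M_(r, s)) :
  row_free (block_mx A 0 0 B) -> row_free A.
Proof.
move=> h; apply: inj_row_free => x xA.
have : row_mx x (0 : 'M_(1, r)) *m block_mx A 0 0 B = 0.
  by rewrite mul_row_block !(mul0mx, mulmx0) !addr0 xA row_mx0.
rewrite -[RHS](mul0mx _ (block_mx A 0 0 B)) => /(row_free_inj h).
by rewrite -row_mx0 => /eq_row_mx[].
Qed.

Lemma row_free_dr p q r s (A : 'M[K]_(p, q)) (B : 'M_(r, s)) :
  row_free (block_mx A 0 0 B) -> row_free B.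
Proof.
move=> h; apply: inj_row_free => x xB.
have : row_mx (0 : 'M_(1, p)) x *m block_mx A 0 0 B = 0.
  by rewrite mul_row_block !(mul0mx, mulmx0) !addr0 add0r xB row_mx0.
rewrite -[RHS](mul0mx _ (block_mx A 0 0 B)) => /(row_free_inj h).
by rewrite -row_mx0 => /eq_row_mx[].
Qed.

Lemma jordan_size_nilpotent nu : jordan_size (nilpotent_blocks K nu) = sumn nu.
Proof. by rewrite /jordan_size -map_comp map_id. Qed.

Lemma size_kronecker_eigenvalues (fin : seq (K * nat)) nu :
  size (kronecker_eigenvalues fin nu) =
  (jordan_size fin + jordan_size (nilpotent_blocks K nu))%N.
Proof.
rewrite size_cat size_nseq jordan_size_nilpotent; congr (_ + _)%N.
rewrite size_flatten /jordan_size /shape -map_comp; congr sumn.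
by apply: eq_map => b /=; rewrite size_nseq.
Qed.

Lemma kronecker_no_eps eta (fin : seq (K * nat)) nu :
  kronecker_form eta fin nu [::] =~
  diag2 (L_blocks K eta)^T (diag2 ('X%:M - cst_mx (jordan_mx fin))
    ('X *: cst_mx (jordan_mx (nilpotent_blocks K nu)) - 1%:M)).
Proof.
apply: eqv_diag2 (eqv_refl _) _; apply: eqv_diag2 (eqv_refl _) _.
exact: eqv_diag2_0r.
Qed.

Lemma kronecker_no_eigenvalue eta (fin : seq (K * nat)) nu eps :
  jordan_size fin = 0%N -> jordan_size (nilpotent_blocks K nu) = 0%N ->
  kronecker_form eta fin nu eps =~ diag2 (L_blocks K eta)^T (L_blocks K eps).
Proof.
move=> f0 n0; apply: eqv_diag2 (eqv_refl _) _.
exact: eqv_trans (eqv_diag2_0l _ _ f0 f0) (eqv_diag2_0l _ _ n0 n0).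
Qed.

Lemma no_eigenvaluesP p q (P : 'M[{poly K}]_(p, q)) :
  no_eigenvalues P <->
  exists eta eps, P =~ diag2 (L_blocks K eta)^T (L_blocks K eps).
Proof.
split=> [[eta [fin [nu [eps [/eqv_strictP h /perm_size/esym/eqP]]]]]|].
  rewrite size_kronecker_eigenvalues addn_eq0 => /andP[/eqP f0 /eqP n0].
  by exists eta, eps; apply: eqv_trans h (kronecker_no_eigenvalue _ _ f0 n0).
case=> eta [eps h]; exists eta, [::], [::], eps; split=> //.
apply/eqv_strictP/(eqv_trans h)/eqv_sym.
exact: kronecker_no_eigenvalue.
Qed.

(** A block L_k^T has more rows than columns, so full row rank at a single point
    excludes it, and only blocks L_k remain. *)
Lemma no_eigenvalues_full_rank p q (M1 M0 : 'M[K]_(p, q)) c :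
  row_free (c *: M1 - M0) -> no_eigenvalues (pencil M1 M0) ->
  row_free M1 /\ forall a, row_free (a *: M1 - M0).
Proof.
move=> free_c /no_eigenvaluesP[eta [eps [E [E' [F [F' [iE iF]]]]]]].
have [N1 [N0 [-> _ _]]] := L_blocks_pencil K eta.
have [L1s [L0s [-> f1 fa]]] := L_blocks_pencil K eps.
rewrite tr_pencil mul_cst_pencil diag2_pencil => /pencil_inj[h1 h0].
have ha a : E *m (a *: M1 - M0) *m F =
    block_mx (a *: N1^T - N0^T) 0 0 (a *: L1s - L0s).
  rewrite mulmxBr mulmxBl -scalemxAr -scalemxAl h1 h0 scale_block_mx.
  by rewrite opp_block_mx add_block_mx !scaler0 !oppr0 !addr0.
have : row_free (c *: N1^T - N0^T).
  by apply: (@row_free_ul _ _ _ _ _ (c *: L1s - L0s)); rewrite -ha (row_free_equiv _ iE iF).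
move/eqP=> rN; have := rank_leq_col (c *: N1^T - N0^T); rewrite rN => le_eta.
have eta0 : eta = [::].
  case: (eta) le_eta => //= k s; rewrite addSn ltnNge => /negP[].
  by apply: leq_add => //; elim: s => //= k' s IH; apply: leq_add.
subst eta; split=> [|a].
  rewrite -(row_free_equiv _ iE iF) h1; apply: row_free_block f1.
  by apply: inj_row_free => x _; apply/rowP=> -[].
rewrite -(row_free_equiv _ iE iF) ha; apply: row_free_block (fa a).
by apply: inj_row_free => x _; apply/rowP=> -[].
Qed.

(** An eigenvalue a of the finite part makes the rank drop at a, and a nonempty
    nilpotent part makes it drop at infinity. *)
Lemma full_rank_no_eigenvalues p q (M1 M0 : 'M[K]_(p, q)) :
  row_free M1 -> (forall a, row_free (a *: M1 - M0)) ->
  no_eigenvalues (pencil M1 M0).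
Proof.
move=> f1 fa.
have [u [A [s [N [k [eps [Nk sim]]]]]]] := full_row_form (fa 0).
have [L1s [L0s [defL _ _]]] := L_blocks_pencil K eps.
have [E [E' [F [F' [iE iF]]]]] := sim.
rewrite defL char_pencil inf_pencil !diag2_pencil mul_cst_pencil.
move=> /pencil_inj[h1 h0].
have u0 : u = 0%N.
  apply/eqP; rewrite -leqn0 leqNgt; apply/negP=> u_gt0.
  have /closed_rootP[a] : size (char_poly A) != 1%N.
    by rewrite size_char_poly eqSS -lt0n.
  rewrite -eigenvalue_root_char => /eigenvalueP[v vA] /negP[]; apply/eqP.
  have fA : row_free (a *: 1%:M - A).
    apply: (@row_free_ul _ _ _ _ _ (a *: block_mx N 0 0 L1s - block_mx 1%:M 0 0 L0s)).
    move: (fa a); rewrite -(row_free_equiv _ iE iF) mulmxBr mulmxBl.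
    rewrite -scalemxAr -scalemxAl h1 h0 scale_block_mx opp_block_mx.
    by rewrite add_block_mx !scaler0 !oppr0 !addr0.
  apply: (row_free_inj fA); rewrite mul0mx mulmxBr -scalemxAr mulmx1 vA.
  by rewrite subrr.
have s0 : s = 0%N.
  have fN : row_free N.
    move: f1; rewrite -(row_free_equiv _ iE iF) h1 => /row_free_dr.
    exact: row_free_ul.
  have fNk j : row_free (N ^+ j).
    elim: j => [|j IH]; first by rewrite expr0 row_free_unit unitmx1.
    by rewrite exprS -mulmxE; apply: row_freeM.
  by have := fNk k; rewrite Nk /row_free mxrank0 => /eqP.
apply/no_eigenvaluesP; exists [::], eps; apply: eqv_trans sim _.
apply: eqv_trans (eqv_diag2_0l _ _ u0 u0) _.
apply: eqv_trans (eqv_diag2_0l _ _ s0 s0) _.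
exact/eqv_sym/eqv_diag2_0l.
Qed.

(** Independent combinations of the rows of a pencil of full row rank have full
    row rank again, and so does what remains of them when zero columns, which
    H inserts in Q, are left out. *)
Lemma no_eigenvalues_compression p q p' q' (M1 M0 : 'M[K]_(p, q)) c
    (Q : 'M[{poly K}]_(p', q')) (E : 'M_(p', p)) (F : 'M_q) (H : 'M_(q', q)) H' :
  row_free (c *: M1 - M0) -> row_free E -> F \in unitmx -> H *m H' = 1%:M ->
  cst_mx E *m pencil M1 M0 *m cst_mx F = Q *m cst_mx H ->
  no_eigenvalues (pencil M1 M0) -> no_eigenvalues Q.
Proof.
move=> free_c fE uF hH defQH /(no_eigenvalues_full_rank free_c)[f1 fa].
have fF : row_free F by rewrite row_free_unit.
have defQ : Q = pencil (E *m M1 *m F *m H') (E *m M0 *m F *m H').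
  rewrite -[Q]mulmx1 -cst_mx1 -hH cst_mxM mulmxA -defQH mul_cst_pencil.
  by rewrite -[LHS]mul1mx -cst_mx1 mulmxA mul_cst_pencil !mul1mx.
move: defQH; rewrite mul_cst_pencil defQ.
rewrite -[X in X *m cst_mx H]mul1mx -cst_mx1 mul_cst_pencil !mul1mx.
case/pencil_inj=> h1 h0; apply: full_rank_no_eigenvalues => [|a].
  by apply: (@row_free_mull _ _ _ _ H); rewrite -h1; do 2!apply: row_freeM => //.
apply: (@row_free_mull _ _ _ _ H).
rewrite mulmxBl -scalemxAl -h1 -h0 scalemxAl scalemxAr -mulmxBl -mulmxBr.
by do 2!apply: row_freeM => //.
Qed.

End RankCriterion.

(** * Unitary deflation *)

Section Deflation.
Variable K : fieldType.

Lemma inverses_ublock r p q (a : 'M[K]_r) (b : 'M_(r, q)) (c : 'M_(p, q)) H :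
  inverses (block_mx a b 0 c) H ->
  exists a' b' c',
    [/\ H = block_mx a' b' 0 c', inverses a a' & inverses c c'].
Proof.
rewrite -(submxK H) => -[].
set a' := ulsubmx H; set b' := ursubmx H; set d' := dlsubmx H; set c' := drsubmx H.
rewrite !mulmx_block !(mul0mx, mulmx0, addr0, add0r) !scalar_mx_block.
move=> /eq_block_mx[_ _ _ hc] /eq_block_mx[ha _ hd hd2].
have [ua' ua] := mulmx1_unit ha.
have d0 : d' = 0 by rewrite -[d'](mulmxK ua) hd mul0mx.
exists a', b', c'; rewrite d0; split=> //.
  by split=> //; apply: mulmx1C.
by split=> //; rewrite -hd2 d0 mul0mx add0r.
Qed.

(** Relative to the bases of the block diagonal form the new ones are block
    triangular.  Hence so is the new form of P, and its diagonal blocks differ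
    from X0 and L by the invertible diagonal blocks of the two base changes. *)
Lemma deflation p q r p2 q2 s t (P : 'M[{poly K}]_(p, q))
    (X0 : 'M[{poly K}]_r) (L : 'M[{poly K}]_(p2, q2)) G G' F F'
    (E : 'M_(r + s, p)) E' (V : 'M_(q, r + t)) V' :
  inverses G G' -> inverses F F' -> cst_mx G *m P *m cst_mx F = diag2 X0 L ->
  inverses E E' -> inverses V V' ->
  dsubmx E *m lsubmx G' = 0 -> dsubmx V' *m lsubmx F = 0 ->
  exists X Y Po, [/\ cst_mx E *m P *m cst_mx V = block_mx X Y 0 Po,
                     X =~ X0 & Po =~ L].
Proof.
move=> iG iF defP iE iV EG VF.
have [g1 [g2 [g3 [defEG [g1' [g2' [g3' [_ ig1 ig3]]]]]]]] :
    exists g1 g2 g3, E *m G' = block_mx g1 g2 0 g3 /\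
    exists g1' g2' g3', [/\ G *m E' = block_mx g1' g2' 0 g3',
                            inverses g1 g1' & inverses g3 g3'].
  have dEG : E *m G' = block_mx (usubmx E *m lsubmx G') (usubmx E *m rsubmx G')
                           0 (dsubmx E *m rsubmx G').
    rewrite -{1}(vsubmxK E) -{1}(hsubmxK G') mul_col_row EG //.
  exists (usubmx E *m lsubmx G'), (usubmx E *m rsubmx G'), (dsubmx E *m rsubmx G').
  split=> //; have := inversesM iE (inverses_sym iG); rewrite dEG.
  exact: inverses_ublock.
have [k1 [k2 [k3 [defVF [k1' [k2' [k3' [defFV ik1 ik3]]]]]]]] :
    exists k1 k2 k3, V' *m F = block_mx k1 k2 0 k3 /\
    exists k1' k2' k3', [/\ F' *m V = block_mx k1' k2' 0 k3',
                            inverses k1 k1' & inverses k3 k3'].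
  have dVF : V' *m F = block_mx (usubmx V' *m lsubmx F) (usubmx V' *m rsubmx F)
                           0 (dsubmx V' *m rsubmx F).
    rewrite -{1}(vsubmxK V') -{1}(hsubmxK F) mul_col_row VF //.
  exists (usubmx V' *m lsubmx F), (usubmx V' *m rsubmx F), (dsubmx V' *m rsubmx F).
  split=> //; have := inversesM (inverses_sym iV) iF; rewrite dVF.
  exact: inverses_ublock.
have defEV : cst_mx E *m P *m cst_mx V =
    cst_mx (E *m G') *m diag2 X0 L *m cst_mx (F' *m V).
  rewrite -defP !cst_mxM !mulmxA -(mulmxA _ (cst_mx G')).
  rewrite (cst_inverses iG).2 mulmx1 -(mulmxA _ (cst_mx F)).
  by rewrite (cst_inverses iF).1 mulmx1.
exists (cst_mx g1 *m X0 *m cst_mx k1').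
exists ((cst_mx g1 *m X0) *m cst_mx k2' + cst_mx g2 *m L *m cst_mx k3').
exists (cst_mx g3 *m L *m cst_mx k3'); split.
- rewrite defEV defEG defFV !cst_mx_block !cst_mx0 /diag2 !mulmx_block.
  by rewrite !(mul0mx, mulmx0, addr0, add0r).
- apply: eqv_sym; exists g1, g1', k1', k1; split=> //; exact: inverses_sym.
apply: eqv_sym; exists g3, g3', k3', k3; split=> //; exact: inverses_sym.
Qed.

End Deflation.

Section Unitary.
Variable C : numClosedFieldType.
Local Open Scope sesquilinear_scope.

Lemma trmxC_mul p q r (A : 'M[C]_(p, q)) (B : 'M_(q, r)) :
  (A *m B)^t* = B^t* *m A^t*.
Proof. by rewrite trmx_mul map_mxM. Qed.

Lemma unitary_inverses p (Q : 'M[C]_p) : Q \is unitarymx -> inverses Q (Q^t*).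
Proof. by move=> /unitarymxP h; split=> //; apply: mulmx1C. Qed.

(** The orthonormal rows produced by the Gram-Schmidt process from the
    adjoint of F span its row space within the first r of them, so the other
    rows are orthogonal to the columns of F. *)
Lemma unitary_triangularization r s (F : 'M[C]_(r + s, r)) :
  exists2 Q : 'M_(r + s), Q \is unitarymx & dsubmx Q *m F = 0.
Proof.
pose A := col_mx (F^t*) 0 : 'M[C]_(r + s); exists (schmidt A).
  exact: schmidt_unitarymx.
set Q := schmidt A.
have /submxP[T FT] : (F^t* <= usubmx Q)%MS.
  apply/row_subP=> i; have := row_schmidt_sub A (lshift s i).
  rewrite rowKu => /submx_trans-> //; apply/sumsmx_subP=> k le_ki.
  rewrite genmxE; have lt_kr := leq_ltn_trans le_ki (ltn_ord i).
  have -> : k = lshift s (Ordinal lt_kr) by apply: val_inj.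
  by rewrite -{1}(vsubmxK (schmidt A)) rowKu row_sub.
have -> : F = (usubmx Q)^t* *m T^t* by rewrite -trmxC_mul -FT trmxCK.
have /unitarymxP : Q \is unitarymx by apply: schmidt_unitarymx.
move: (usubmx Q) (dsubmx Q) (vsubmxK Q) => Q1 Q2 <-.
rewrite tr_col_mx map_row_mx mul_col_row.
rewrite scalar_mx_block => /eq_block_mx[_ _ h _].
by rewrite mulmxA h mul0mx.
Qed.

End Unitary.

Section UnitaryDeflation.
Variable C : numClosedFieldType.
Local Open Scope sesquilinear_scope.

(** These identity matrices reassociate the partition of the rows into three
    blocks, which lets P be seen as a 2 x 2 block matrix. *)
Definition regroup (K : fieldType) u v w : 'M[K]_(u + v + w, u + (v + w)) :=
  block_mx (col_mx 1%:M 0) (col_mx 0 (row_mx 1%:M 0)) 0 (row_mx 0 1%:M).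

Definition ungroup (K : fieldType) u v w : 'M[K]_(u + (v + w), u + v + w) :=
  block_mx (row_mx 1%:M 0) 0 (col_mx (row_mx 0 1%:M) 0) (col_mx 0 1%:M).

Lemma inverses_regroup (K : fieldType) u v w :
  inverses (regroup K u v w) (ungroup K u v w).
Proof.
split; rewrite /regroup /ungroup mulmx_block ?mul_col_row ?mul_col_mx ?mul_row_col;
  rewrite ?mul_col_mx ?mul_mx_row ?mul_col_row ?mul_row_col;
  rewrite !(mul0mx, mulmx0, mul1mx, mulmx1, addr0, add0r).
  rewrite !(row_mx0, col_mx0, addr0).
  have -> : col_mx 0 (row_mx 0 1%:M) = block_mx 0 0 0 1%:M :> 'M[K]_(u + v).
    by rewrite block_mxEv row_mx0.
  by rewrite add_block_mx !(addr0, add0r) -!scalar_mx_block.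
have -> : col_mx (row_mx 1%:M 0) 0 = block_mx 1%:M 0 0 0 :> 'M[K]_(v + w).
  by rewrite block_mxEv row_mx0.
rewrite !(row_mx0, col_mx0, addr0) add_block_mx !(addr0, add0r).
by rewrite -!scalar_mx_block.
Qed.

Lemma staircase_unitary u v w (W11 : 'M[C]_u) (W13 : 'M_(u, w)) W31 (W33 : 'M_w) :
  block_mx W11 W13 W31 W33 \is unitarymx ->
  block_mx (block_mx W11 0 0 (1%:M : 'M_v)) (col_mx W13 0) (row_mx W31 0) W33
    \is unitarymx.
Proof.
move=> /unitarymxP h; apply/unitarymxP; move: h.
rewrite !tr_block_mx !map_block_mx !mulmx_block !scalar_mx_block.
move=> /eq_block_mx[h1 h2 h3 h4].
rewrite tr_row_mx tr_col_mx map_col_mx map_row_mx !trmx0 trmx1 !map_mx0 map_mx1.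
rewrite ?mulmx_block !mul_col_row !mul_row_block !mul_block_col !mul_row_col.
rewrite !mul_col_mx !mul_mx_row.
rewrite !(mul0mx, mulmx0, mul1mx, mulmx1, addr0, add0r).
rewrite add_block_mx add_row_mx add_col_mx !(addr0, add0r).
by rewrite h1 h2 h3 h4 row_mx0 col_mx0.
Qed.

(** Let Ea and Eb be the two parts of the first columns of the inverse of G, and
    F1 the first columns of F.  Since U empties the last rows of Ea and leaves S,
    the matrix with blocks W11, W13, W31, W33 only has to empty the last rows of
    S on top of Eb.  In (c A1 - A0) F1 = Ea (c X1 - X0) the left-hand side has
    independent columns, so S and c X1 - X0 are invertible.  Hence if x W33 = 0,
    the relation W31 S + W33 Eb = 0 gives x W31 = 0, and the rows of a unitary
    matrix being independent, x = 0. *)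
Lemma unitary_staircase u v m (c : C) (A1 A0 : 'M[C]_(u + v))
    (C1 C0 : 'M_(m, u + v)) p q (X1 X0 : 'M_u) (L1 L0 : 'M_(p, q))
    (G : 'M_(u + p, u + v + m)) G' (F : 'M_(u + v, u + q)) F' :
  c *: A1 - A0 \in unitmx -> inverses G G' -> inverses F F' ->
  G *m col_mx A1 C1 *m F = block_mx X1 0 0 L1 ->
  G *m col_mx A0 C0 *m F = block_mx X0 0 0 L0 ->
  exists (U V : 'M_(u + v)) (W11 : 'M_u) W13 W31 (W33 : 'M_m) X Y Ao Co,
    let W := block_mx (block_mx W11 0 0 (1%:M : 'M_v)) (col_mx W13 0)
                      (row_mx W31 0)                    W33 in
    [/\ [/\ U \is unitarymx, V \is unitarymx & W \is unitarymx],
        W33 \in unitmx,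
        cst_mx (W *m block_mx U 0 0 1%:M) *m pencil (col_mx A1 C1) (col_mx A0 C0)
          *m cst_mx V = col_mx (block_mx X Y 0 Ao) (row_mx 0 Co),
        X =~ pencil X1 X0 /\ c *: X1 - X0 \in unitmx &
        col_mx Ao Co =~ pencil L1 L0].
Proof.
move=> uA iG iF h1 h0.
pose Ea := usubmx (lsubmx G'); pose Eb := dsubmx (lsubmx G').
have [U uU UEa] := unitary_triangularization Ea.
pose S := usubmx U *m Ea.
have defUEa : U *m Ea = col_mx S 0.
  by rewrite -[LHS]vsubmxK -mul_usub_mx -mul_dsub_mx UEa.
have defEa : Ea = lsubmx (U^t*) *m S.
  have [_ iU] := unitary_inverses uU.
  rewrite -[LHS]mul1mx -iU -mulmxA defUEa -{1}[U^t*]hsubmxK mul_row_col.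
  by rewrite mulmx0 addr0.
have [uS uX] : S \in unitmx /\ c *: X1 - X0 \in unitmx.
  have PF : (c *: col_mx A1 C1 - col_mx A0 C0) *m F
            = G' *m block_mx (c *: X1 - X0) 0 0 (c *: L1 - L0).
    have -> : block_mx (c *: X1 - X0) 0 0 (c *: L1 - L0) =
              c *: block_mx X1 0 0 L1 - block_mx X0 0 0 L0.
      by rewrite scale_block_mx opp_block_mx add_block_mx !scaler0 !oppr0 !addr0.
    rewrite -h1 -h0 -!mulmxA scalemxAr -mulmxBr mulmxA iG.2 mul1mx scalemxAl.
    by rewrite -mulmxBl.
  have AF : (c *: A1 - A0) *m lsubmx F = Ea *m (c *: X1 - X0).
    have /(congr1 (fun M => usubmx (lsubmx M))) := PF.
    rewrite -mulmx_lsub -mul_usub_mx scale_col_mx opp_col_mx add_col_mx col_mxKu => ->.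
    by rewrite -{1}(hsubmxK G') mul_row_block !mulmx0 addr0 row_mxKl -mul_usub_mx.
  have FF : usubmx F' *m lsubmx F = 1%:M.
    by rewrite mul_usub_mx mulmx_lsub iF.2 scalar_mx_block block_mxEh row_mxKl col_mxKu.
  have : usubmx F' *m invmx (c *: A1 - A0) *m lsubmx (U^t*) *m S *m (c *: X1 - X0) = 1%:M.
    by rewrite -(mulmxA _ _ S) -defEa -(mulmxA _ Ea) -AF mulmxA mulmxKV.
  by case/mulmx1_unit; rewrite unitmx_mul => /andP[].
have [Wh uWh WhE] := unitary_triangularization (col_mx S Eb).
have [Q uQ QF] := unitary_triangularization (lsubmx F).
pose W11 := ulsubmx Wh; pose W13 := ursubmx Wh.
pose W31 := dlsubmx Wh; pose W33 := drsubmx Wh.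
have defWh : Wh = block_mx W11 W13 W31 W33 by rewrite submxK.
have W3E : W31 *m S + W33 *m Eb = 0.
  by move: WhE; rewrite defWh block_mxEv col_mxKd mul_row_col.
have uW33 : W33 \in unitmx.
  rewrite -row_free_unit; apply: inj_row_free => x xW33.
  have xW31 : x *m W31 = 0.
    rewrite -[LHS](mulmxK uS) -(mulmxA x) -[W31 *m S](addrK (W33 *m Eb)) W3E sub0r.
    by rewrite mulmxN mulmxA xW33 mul0mx oppr0 mul0mx.
  have : row_mx 0 x *m Wh = 0.
    by rewrite defWh mul_row_block !mul0mx !add0r xW31 xW33 row_mx0.
  move/(congr1 (mulmx^~ (Wh^t*))); rewrite /= mulmxtVK // mul0mx -row_mx0.
  by case/eq_row_mx.
pose W := block_mx (block_mx W11 0 0 (1%:M : 'M_v)) (col_mx W13 0)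
                   (row_mx W31 0)                    W33.
have uW : W \is unitarymx by apply: staircase_unitary; rewrite -defWh.
pose T := W *m block_mx U 0 0 1%:M.
have iT : inverses T (block_mx (U^t*) 0 0 1%:M *m W^t*).
  apply: inversesM (unitary_inverses uW) _.
  exact: inverses_diag (unitary_inverses uU) (inverses1 _ _).
pose J' := ungroup C u v m.
have iJ := inverses_sym (inverses_regroup C u v m).
have TE : dsubmx (J' *m T) *m lsubmx G' = 0.
  have -> : dsubmx (J' *m T) *m lsubmx G' = dsubmx (J' *m (T *m lsubmx G')).
    by rewrite mul_dsub_mx -(mulmxA J' T).
  have -> : T *m lsubmx G' = col_mx (col_mx (W11 *m S + W13 *m Eb) 0) 0.
    rewrite -mulmxA -[lsubmx G']vsubmxK (mul_block_col U) !mul0mx addr0 add0r.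
    rewrite mul1mx defUEa (mul_block_col (block_mx W11 _ _ _)) mul_block_col.
    rewrite !(mul0mx, mulmx0, addr0) mul_col_mx mul0mx add_col_mx addr0.
    by rewrite mul_row_col mulmx0 addr0 W3E.
  rewrite /J' /ungroup mul_block_col mulmx0 addr0 mul_col_mx.
  by rewrite !mul_row_col !(mul0mx, mulmx0, add0r, addr0) mul1mx col_mxKd col_mx0.
have defGPF : cst_mx G *m pencil (col_mx A1 C1) (col_mx A0 C0) *m cst_mx F
              = diag2 (pencil X1 X0) (pencil L1 L0).
  by rewrite mul_cst_pencil h1 h0 diag2_pencil.
have [X [Y [Po [defP simX simPo]]]] :=
  deflation iG iF defGPF (inversesM iJ iT) (inverses_sym (unitary_inverses uQ)) TE QF.
exists U, (Q^t*), W11, W13, W31, W33, X, Y, (usubmx Po), (dsubmx Po).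
rewrite -/W -/T; split=> //; last by rewrite vsubmxK.
  by split=> //; rewrite trmxC_unitary.
have [hJ _] := cst_inverses (inverses_sym iJ).
rewrite -[LHS]mul1mx -hJ -mulmxA !mulmxA -(mulmxA _ (cst_mx (ungroup C u v m))) -cst_mxM.
rewrite -!mulmxA (mulmxA _ _ (cst_mx (Q^t*))) defP.
rewrite /regroup cst_mx_block !cst_mx_col !cst_mx_row !cst_mx0 !cst_mx1.
move: (usubmx Po) (dsubmx Po) (vsubmxK Po) => P1 P2 <-.
rewrite mulmx_block !mul_col_mx !mul_row_col.
rewrite !(mul0mx, mulmx0, mul1mx, addr0, add0r) add_col_mx addr0 add0r.
by rewrite block_mxEv add_col_mx addr0 add0r -(block_mxEh X).
Qed.

End UnitaryDeflation.

(** * The reduced system *)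

Section Realization.

Lemma staircase_mul (K : fieldType) u v m n (W11 : 'M[K]_u) W13 W31 (W33 : 'M_m)
    (U : 'M_(u + v)) (P : 'M[{poly K}]_(u + v, n)) Q :
  cst_mx (block_mx (block_mx W11 0 0 1%:M) (col_mx W13 0) (row_mx W31 0) W33
            *m block_mx U 0 0 1%:M) *m col_mx P Q =
  col_mx (col_mx (cst_mx W11 *m usubmx (cst_mx U *m P) + cst_mx W13 *m Q)
                 (dsubmx (cst_mx U *m P)))
         (cst_mx W31 *m usubmx (cst_mx U *m P) + cst_mx W33 *m Q).
Proof.
rewrite cst_mxM !cst_mx_block cst_mx_col cst_mx_row !(cst_mx0, cst_mx1) -mulmxA.
rewrite (mul_block_col (cst_mx U)) !mul0mx mul1mx addr0 add0r.
move: (cst_mx U *m P) => M; rewrite -{1}[M]vsubmxK !mul_block_col mul_col_mx mul_row_col.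
by rewrite !mul0mx mul1mx !addr0 add0r add_col_mx addr0.
Qed.

(** Express both sides through the solution y of a' y = b'.  The last rows of
    this equation say that Ao^-1 times the last rows of b' is the last part of
    y; the first ones make the terms with w31 cancel. *)
Lemma transfer_identity (F : fieldType) u v m n (a : 'M[F]_(u + v)) (b : 'M_(_, n))
    (c : 'M_(m, _)) (d : 'M_(m, n)) U V (Ao : 'M_v) (Co : 'M_(m, v)) w31 w33 :
  let a' := U *m a *m V in let b' := U *m b in
  a \in unitmx -> U \in unitmx -> V \in unitmx ->
  dsubmx a' = row_mx 0 Ao ->
  w31 *m usubmx a' + w33 *m (c *m V) = row_mx 0 Co ->
  Co *m invmx Ao *m dsubmx b' + (w33 *m d - w31 *m usubmx b') =
  w33 *m (c *m invmx a *m b + d).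
Proof.
move=> a' b' ua uU uV hAo hCo.
have ua' : a' \in unitmx by rewrite !unitmx_mul uU ua uV.
have uAo : Ao \in unitmx.
  move: ua'; rewrite -[a']vsubmxK hAo -[usubmx a']hsubmxK -block_mxEv unitmxE.
  by rewrite det_ublock unitrM => /andP[].
have [y ay defb] : exists2 y, a' *m y = b' & invmx a *m b = V *m y.
  exists (invmx a' *m b'); first by rewrite mulKVmx.
  rewrite -[RHS](mulKmx ua); congr (_ *m _); apply: (can_inj (mulKmx uU)).
  by rewrite !mulmxA (mulmxV ua') mul1mx.
have cy : row_mx 0 Co *m y = Co *m invmx Ao *m dsubmx b'.
  rewrite -ay -mul_dsub_mx hAo -[y]vsubmxK !mul_row_col !mul0mx !add0r.
  by rewrite -mulmxA mulKmx.
rewrite -cy -hCo mulmxDl -mulmxA mul_usub_mx ay -(mulmxA c) defb mulmxDr !mulmxA.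
by rewrite -!addrA addrCA [in RHS]addrC addrA addrACA subrr addr0 addrC.
Qed.

Lemma transfer_function_reduction (K : fieldType) u v m n
    (A : 'M[{poly K}]_(u + v)) (B : 'M_(u + v, n)) (C : 'M_(m, u + v))
    (D : 'M_(m, n)) (U V : 'M[K]_(u + v)) (W31 : 'M_(m, u)) (W33 : 'M_m)
    (Ao : 'M_v) (Co : 'M_(m, v)) :
  is_regular A -> U \in unitmx -> V \in unitmx ->
  dsubmx (cst_mx U *m (A *m cst_mx V)) = row_mx 0 Ao ->
  cst_mx W31 *m usubmx (cst_mx U *m (A *m cst_mx V))
    + cst_mx W33 *m (C *m cst_mx V) = row_mx 0 Co ->
  transfer_function Ao (dsubmx (cst_mx U *m B)) Co
    (cst_mx W33 *m D - cst_mx W31 *m usubmx (cst_mx U *m B)) =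
  rat_mx (cst_mx W33) *m transfer_function A B C D.
Proof.
move=> regA uU uV defAo defCo; rewrite /transfer_function.
have ratM p q r (M : 'M[{poly K}]_(p, q)) (N : 'M_(q, r)) :
  rat_mx (M *m N) = rat_mx M *m rat_mx N by apply: map_mxM.
have ratU p q r (M : 'M[{poly K}]_(p + q, r)) :
  usubmx (rat_mx M) = rat_mx (usubmx M) by rewrite /rat_mx map_usubmx.
have ratD p q r (M : 'M[{poly K}]_(p + q, r)) :
  dsubmx (rat_mx M) = rat_mx (dsubmx M) by rewrite /rat_mx map_dsubmx.
have rat_row0 p q r (M : 'M[{poly K}]_(p, q)) :
  row_mx (0 : 'M_(p, r)) (rat_mx M) = rat_mx (row_mx 0 M).
  by rewrite /rat_mx map_row_mx map_mx0.
have rat_unit p (M : 'M[{poly K}]_p) : \det M != 0 -> rat_mx M \in unitmx.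
  by move=> detM; rewrite unitmxE unitfE det_map_mx tofrac_eq0.
have cst_unit p (M : 'M[K]_p) : M \in unitmx -> rat_mx (cst_mx M) \in unitmx.
  by move=> uM; rewrite rat_unit // det_map_mx polyC_eq0 -unitfE -unitmxE.
rewrite -(@transfer_identity _ u v m n (rat_mx A) (rat_mx B) (rat_mx C)
   (rat_mx D) (rat_mx (cst_mx U)) (rat_mx (cst_mx V)) (rat_mx Ao) (rat_mx Co)
   (rat_mx (cst_mx W31)) (rat_mx (cst_mx W33))) ?cst_unit ?rat_unit //.
- by rewrite -!ratM ratU ratD -ratM; congr (_ + _); apply: map_mxB.
- by rewrite -!ratM ratD rat_row0 -mulmxA -defAo.
by rewrite -!ratM ratU -ratM rat_row0 -defCo -(mulmxA (cst_mx U)) /rat_mx map_mxD.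
Qed.

Lemma is_pencil_col_mx (K : fieldType) p q r (P : 'M[{poly K}]_(p, q)) (Q : 'M_(r, q)) :
  is_pencil (col_mx P Q) <-> is_pencil P /\ is_pencil Q.
Proof.
split=> [h|[/is_pencilP hP /is_pencilP hQ]].
  split; [rewrite -(col_mxKu P Q) | rewrite -(col_mxKd P Q)];
    by move/is_pencilP: h => h; apply/is_pencilP=> i j; rewrite mxE.
by apply/is_pencilP=> i j; rewrite mxE; case: split => k.
Qed.

Lemma is_pencil_row_mx (K : fieldType) p q r (P : 'M[{poly K}]_(p, q)) (Q : 'M_(p, r)) :
  is_pencil (row_mx P Q) <-> is_pencil P /\ is_pencil Q.
Proof.
split=> [h|[/is_pencilP hP /is_pencilP hQ]].
  split; [rewrite -(row_mxKl P Q) | rewrite -(row_mxKr P Q)];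
    by move/is_pencilP: h => h; apply/is_pencilP=> i j; rewrite mxE.
by apply/is_pencilP=> i j; rewrite mxE; case: split => k.
Qed.

Lemma is_pencilN (K : fieldType) p q (P : 'M[{poly K}]_(p, q)) :
  is_pencil (- P) <-> is_pencil P.
Proof.
by split=> /is_pencilP h; apply/is_pencilP=> i j; move: (h i j); rewrite !mxE size_polyN.
Qed.

Lemma det_pencil_eval (K : fieldType) p (M1 M0 : 'M[K]_p) c :
  (\det (pencil M1 M0)).[c] = \det (c *: M1 - M0).
Proof.
rewrite -[LHS]/(horner_eval c _) -det_map_mx; congr (\det _); apply/matrixP=> i j.
by rewrite !mxE /= /horner_eval !hornerE.
Qed.

Lemma eqv_regular (K : fieldType) p (P Q : 'M[{poly K}]_p) :
  P =~ Q -> is_regular Q -> is_regular P.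
Proof.
case=> E [E' [F [F' [_ _ <-]]]]; rewrite /is_regular !det_mulmx !mulf_eq0 !negb_or.
by case/andP=> /andP[].
Qed.

End Realization.

(** * The reduction *)

(** Only unitary matrices and algebraic closedness are involved, so the reduction
    is valid over every algebraically closed numeric field. *)
Lemma observable_reduction (K : numClosedFieldType) (d m n : nat)
    (A : 'M[{poly K}]_d) (B : 'M[{poly K}]_(d, n))
    (C : 'M[{poly K}]_(m, d)) (D : 'M[{poly K}]_(m, n))
    (G : 'M[{fraction {poly K}}]_(m, n))
    (hG : realizes A B C D G) :
  exists (dn do : nat) (ed : (dn + do)%N = d)
    (U V : 'M[K]_d) (W : 'M[K]_(d + m))
    (W11 : 'M[K]_dn) (W13 : 'M[K]_(dn, m))
    (W31 : 'M[K]_(m, dn)) (W33 : 'M[K]_m)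
    (X : 'M[{poly K}]_dn) (Y : 'M[{poly K}]_(dn, do))
    (Z : 'M[{poly K}]_(dn, n))
    (Ao : 'M[{poly K}]_do) (Bo : 'M[{poly K}]_(do, n))
    (Co : 'M[{poly K}]_(m, do)) (Do : 'M[{poly K}]_(m, n)),
    let em := congr1 (addn^~ m) ed in
    let en := congr1 (addn^~ n) ed in
    [/\ U \is unitarymx, V \is unitarymx & W \is unitarymx] /\
    W = castmx (em, em)
          (block_mx (block_mx W11 0 0 (1%:M : 'M_do)) (col_mx W13 0)
                    (row_mx W31 0)                    W33) /\
    cst_mx W *m block_mx (cst_mx U) 0 0 1%:M *m block_mx A (- B) C D
      *m block_mx (cst_mx V) 0 0 1%:M
      = castmx (em, en)
          (block_mx (block_mx X Y 0 Ao) (col_mx Z (- Bo))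
                    (row_mx 0 Co)       Do) /\
    (is_pencil X /\ is_regular X) /\
    (exists s : seq (option K),
      [/\ eigenvalues_of (col_mx A C) s, dn = size s & eigenvalues_of X s]) /\
    no_eigenvalues (col_mx Ao Co) /\
    (realizes Ao Bo Co Do (rat_mx (cst_mx W33) *m G) /\ W33 \in unitmx) /\
    (no_eigenvalues (row_mx A (- B)) -> no_eigenvalues (row_mx Ao (- Bo))).
Proof.
case: hG => -[pA pB pC pD regA] defG.
have [A1 [A0 defA]] : exists A1 A0, A = pencil A1 A0 by [].
have [C1 [C0 defC]] : exists C1 C0, C = pencil C1 C0 by [].
have [c root_c] := closed_nonrootP _ regA.
have uA : c *: A1 - A0 \in unitmx.
  by rewrite unitmxE unitfE -det_pencil_eval -defA.
have defP : col_mx A C = pencil (col_mx A1 C1) (col_mx A0 C0).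
  by rewrite defA defC /pencil !cst_mx_col scale_col_mx opp_col_mx add_col_mx.
have free_c : row_free (c *: col_mx A1 C1 - col_mx A0 C0)^T.
  rewrite scale_col_mx opp_col_mx add_col_mx tr_col_mx.
  apply: (@row_free_mull _ _ _ _ _ (col_mx 1%:M 0)).
  by rewrite mul_row_col mulmx1 mulmx0 addr0 row_free_unit unitmx_tr.
have [fin [nu [eta sim]]] := full_column_kronecker free_c.
have [N1 [N0 [defL _ _]]] := L_blocks_pencil K eta.
have [G1 [G1' [F [F' [iG iF]]]]] := sim.
set u := (jordan_size fin + jordan_size (nilpotent_blocks K nu))%N in G1 G1' F F' iG iF *.
set v := sumn eta in F F' iF *.
have ed := inverses_dim iF.
subst d.
rewrite char_pencil inf_pencil diag2_pencil defL.
set X1 := block_mx 1%:M 0 0 _; set X0 := block_mx _ 0 0 1%:M.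
rewrite tr_pencil mul_cst_pencil diag2_pencil => /pencil_inj[h1 h0].
have [U [V [W11 [W13 [W31 [W33 [X [Y [Ao [Co]]]]]]]]]] :=
  unitary_staircase uA iG iF h1 h0.
set W := block_mx (block_mx W11 0 0 1%:M) _ _ _.
move=> [[uU uV uW] uW33 defM [simX uX] simO].
pose Q := cst_mx (W *m block_mx U 0 0 1%:M) *m col_mx (- B) D.
exists u, v, erefl, U, V, W, W11, W13, W31, W33, X, Y, (usubmx (usubmx Q)).
exists Ao, (- dsubmx (usubmx Q)), Co, (dsubmx Q) => em en.
split=> //; split; first by rewrite castmx_id.
rewrite opprK.
(* The three block columns of the identity: the first two come from the
   deflation of the pencil of A and C, the last one defines Z, Bo and Do. *)
have big : cst_mx W *m block_mx (cst_mx U) 0 0 1%:M *m block_mx A (- B) C D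
      *m block_mx (cst_mx V) 0 0 1%:M
    = block_mx (block_mx X Y 0 Ao) (col_mx (usubmx (usubmx Q)) (dsubmx (usubmx Q)))
               (row_mx 0 Co) (dsubmx Q).
  rewrite !vsubmxK [RHS]block_mxEh vsubmxK -defM -defP /Q cst_mxM.
  rewrite (cst_mx_block U) !cst_mx0 cst_mx1 -mulmxA (block_mxEh A) mul_row_block !mulmx0.
  by rewrite mulmx1 addr0 add0r mul_mx_row !mulmxA.
split; first by rewrite castmx_id.
have pM : is_pencil (col_mx (block_mx X Y 0 Ao) (row_mx 0 Co)).
  by rewrite -defM mul_cst_pencil; do 2!eexists.
have [B1 [B0 defB]] := pB; have [D1 [D0 defD]] := pD.
have pQ : is_pencil Q.
  have defBD : col_mx (- B) D = pencil (col_mx (- B1) D1) (col_mx (- B0) D0).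
    rewrite defB defD /pencil !cst_mx_col !cst_mxN scale_col_mx opp_col_mx.
    by rewrite add_col_mx scalerN opprB opprK addrC.
  rewrite -[Q]mulmx1 -cst_mx1 /Q defBD mul_cst_pencil.
  by do 2!eexists.
have [pXYA pCo] : is_pencil (block_mx X Y 0 Ao) /\ is_pencil Co.
  by move/is_pencil_col_mx: pM => [? /is_pencil_row_mx[]].
have [pX pAo] : is_pencil X /\ is_pencil Ao.
  move: pXYA; rewrite block_mxEv => /is_pencil_col_mx[/is_pencil_row_mx[? _]].
  by case/is_pencil_row_mx.
have [pQ1 pDo] : is_pencil (usubmx Q) /\ is_pencil (dsubmx Q).
  by move: pQ; rewrite -{1}[Q]vsubmxK => /is_pencil_col_mx.
have pBo : is_pencil (dsubmx (usubmx Q)).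
  by move: pQ1; rewrite -{1}[usubmx Q]vsubmxK => /is_pencil_col_mx[].
move: defM; rewrite -defP -mulmxA (mul_col_mx A) staircase_mul.
rewrite block_mxEv => /eq_col_mx[/eq_col_mx[defXY defAo] defCo].
have defQ := staircase_mul W11 W13 W31 W33 U (- B) D.
have defBo : dsubmx (usubmx Q) = - dsubmx (cst_mx U *m B).
  by rewrite /Q defQ col_mxKu col_mxKd mulmxN linearN.
have defDo : dsubmx Q = cst_mx W33 *m D - cst_mx W31 *m usubmx (cst_mx U *m B).
  by rewrite /Q defQ col_mxKd mulmxN linearN mulmxN addrC.
rewrite defBo opprK in pBo *; rewrite {}defDo in pDo *.
have regX : is_regular X.
  apply: eqv_regular simX _; rewrite /is_regular.
  apply/eqP=> /(congr1 (horner_eval c)); rewrite rmorph0 /horner_eval det_pencil_eval.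
  by apply/eqP; rewrite -unitfE -unitmxE.
have detC p (M : 'M[K]_p) : M \is unitarymx -> \det (cst_mx M) != 0.
  move=> /unitarymx_unit; rewrite unitmxE unitfE det_map_mx => detM.
  by rewrite polyC_eq0.
have regUAV : \det (cst_mx U *m (A *m cst_mx V)) != 0.
  by rewrite !det_mulmx !mulf_neq0 ?detC.
have regAo : is_regular Ao.
  move: regUAV; rewrite -[_ *m _]vsubmxK defAo -[usubmx _]hsubmxK -block_mxEv.
  by rewrite det_ublock mulf_eq0 negb_or => /andP[].
split=> //; split.
  exists (kronecker_eigenvalues fin nu); rewrite size_kronecker_eigenvalues.
  split=> //.
    exists eta, fin, nu, [::]; split=> //; apply/eqv_strictP.
    rewrite defP; apply: eqv_trans sim _.
    exact: eqv_trans (eqv_diag2C _ _) (eqv_sym (kronecker_no_eps _ _ _)).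
  exists [::], fin, nu, [::]; split=> //; apply/eqv_strictP.
  apply: eqv_trans simX _; rewrite -diag2_pencil -char_pencil -inf_pencil.
  apply/eqv_sym/(eqv_trans (kronecker_no_eps _ _ _)).
  exact: eqv_diag2_0l.
split.
  apply/no_eigenvaluesP; exists eta, [::]; apply: eqv_trans simO _.
  apply/eqv_sym/(eqv_trans (eqv_diag2_0r _ _ _ _)) => //.
  by rewrite defL tr_pencil; apply: eqv_refl.
split.
  split=> //; split; first by split=> //; apply/is_pencilN.
  rewrite -defG; apply: (@transfer_function_reduction _ _ _ _ _ _ _ _ _ _ V) => //;
    exact: unitarymx_unit.
have defAB : row_mx A (- B) = pencil (row_mx A1 (- B1)) (row_mx A0 (- B0)).
  rewrite defA defB /pencil !cst_mx_row !cst_mxN scale_row_mx opp_row_mx.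
  by rewrite add_row_mx scalerN opprB opprK [_ - 'X *: cst_mx B1]addrC.
rewrite defAB.
apply: (@no_eigenvalues_compression _ _ _ _ _ _ _ c _ (dsubmx U)
  (block_mx V 0 0 1%:M) (block_mx (row_mx 0 1%:M) 0 0 1%:M)
  (block_mx (col_mx 0 1%:M) 0 0 1%:M)).
- rewrite scale_row_mx opp_row_mx add_row_mx.
  apply: (@row_free_mull _ _ _ _ _ (col_mx 1%:M 0)).
  by rewrite mul_row_col mulmx1 mulmx0 addr0 row_free_unit.
- apply: inj_row_free => x xU; have : row_mx 0 x *m U = 0.
    by rewrite -[U]vsubmxK mul_row_col mul0mx add0r.
  rewrite -[X in _ = X -> _](mul0mx _ U) => /(can_inj (mulmxK (unitarymx_unit uU))).
  by rewrite -row_mx0 => /eq_row_mx[].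
- by rewrite unitmxE det_ublock det1 mulr1 -unitmxE unitarymx_unit.
- rewrite mulmx_block !(mul0mx, mulmx0, mul1mx, addr0, add0r) mul_row_col.
  by rewrite mul0mx mul1mx add0r -scalar_mx_block.
rewrite -defAB !cst_mx_block cst_mx_row !(cst_mx0, cst_mx1) mul_mx_row.
rewrite !mul_row_block !(mulmx0, mulmx1, addr0, add0r) mul_mx_row mulmx0 mulmx1.
rewrite -defAo mulmxN -!mul_dsub_mx !mulmxA.
by have -> : cst_mx (dsubmx U) = dsubmx (cst_mx U) by rewrite /cst_mx map_dsubmx.
Qed.

(* dn and do are the sizes of the non-observable and observable parts; the
   casts along ed : dn + do = d only identify the equal sizes
   (dn + do) + m = d + m and (dn + do) + n = d + n. *)
Theorem theorem7 (R : realType) (d m n : nat)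
    (A : 'M[{poly R[i]}]_d) (B : 'M[{poly R[i]}]_(d, n))
    (C : 'M[{poly R[i]}]_(m, d)) (D : 'M[{poly R[i]}]_(m, n))
    (G : 'M[{fraction {poly R[i]}}]_(m, n))
    (hG : realizes A B C D G) :
  exists (dn do : nat) (ed : (dn + do)%N = d)
    (U V : 'M[R[i]]_d) (W : 'M[R[i]]_(d + m))
    (W11 : 'M[R[i]]_dn) (W13 : 'M[R[i]]_(dn, m))
    (W31 : 'M[R[i]]_(m, dn)) (W33 : 'M[R[i]]_m)
    (X : 'M[{poly R[i]}]_dn) (Y : 'M[{poly R[i]}]_(dn, do))
    (Z : 'M[{poly R[i]}]_(dn, n))
    (Ao : 'M[{poly R[i]}]_do) (Bo : 'M[{poly R[i]}]_(do, n))
    (Co : 'M[{poly R[i]}]_(m, do)) (Do : 'M[{poly R[i]}]_(m, n)),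
    let em := congr1 (addn^~ m) ed in
    let en := congr1 (addn^~ n) ed in
    [/\ U \is unitarymx, V \is unitarymx & W \is unitarymx] /\
    W = castmx (em, em)
          (block_mx (block_mx W11 0 0 (1%:M : 'M_do)) (col_mx W13 0)
                    (row_mx W31 0)                    W33) /\
    cst_mx W *m block_mx (cst_mx U) 0 0 1%:M *m block_mx A (- B) C D
      *m block_mx (cst_mx V) 0 0 1%:M
      = castmx (em, en)
          (block_mx (block_mx X Y 0 Ao) (col_mx Z (- Bo))
                    (row_mx 0 Co)       Do) /\
    (is_pencil X /\ is_regular X) /\
    (exists s : seq (option R[i]),
      [/\ eigenvalues_of (col_mx A C) s, dn = size s & eigenvalues_of X s]) /\
    no_eigenvalues (col_mx Ao Co) /\
    (realizes Ao Bo Co Do (rat_mx (cst_mx W33) *m G) /\ W33 \in unitmx) /\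
    (no_eigenvalues (row_mx A (- B)) -> no_eigenvalues (row_mx Ao (- Bo))).
Proof. exact: observable_reduction hG. Qed.
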